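(* Let $A:\mathbb{R}^n\rightrightarrows\mathbb{R}^n$ be a maximal monotone operator and let $F:\mathbb{R}^n\rightrightarrows\mathbb{R}^n$ be an $L$-Lipschitz Cusco mapping. Let $S$ be a closed subset of $\overline{\mathrm{dom}\,A}$ satisfying $\Pi_S(x)\subset S\cap \mathrm{dom}\,A$ for all $x\in\mathrm{dom}\,A$. Let $\mathrm{N}_S$ stand for either $\mathrm{N}_S^P$ or $\mathrm{N}_S^F$, and let $\mathrm{T}_S$ stand for either $\mathrm{T}_S^B$ or $\overline{\mathrm{co}}\,\mathrm{T}_S^B$. Then the following statements are equivalent: (i) $S$ is strong invariant for the differential inclusion $\dot x(t)\in F(x(t))-A(x(t))$ a.e. $t\ge 0$, $x(0)=x_0\in\overline{\mathrm{dom}\,A}$. (ii) For every $x\in S\cap\mathrm{dom}\,A$, one has $v-\Pi_{A(x)}(v)\in \mathrm{T}_S(x)$ for all $v\in F(x)$. (iii) For every $x\in S\cap\mathrm{dom}\,A$, one has $[v-A(x)]\cap \mathrm{T}_S(x)\neq\emptyset$ for all $v\in F(x)$. (iv) For every $x\in S\cap\mathrm{dom}\,A$, one has $$\sup_{\xi\in \mathrm{N}_S(x)}\ \sup_{v\in F(x)}\langle \xi, v-\Pi_{A(x)}(v)\rangle\le 0.$$ (v) For every $x\in S\cap\mathrm{dom}\,A$, one has $$\sup_{\xi\in \mathrm{N}_S(x)}\ \sup_{v\in F(x)}\ \inf_{x^*\in A(x)}\langle \xi, v-x^*\rangle\le 0.$$ (vi) For every $x\in S\cap\mathrm{dom}\,A$,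 one has $$\sup_{\xi\in \mathrm{N}_S(x)}\ \sup_{v\in F(x)}\ \inf_{x^*\in A(x)\cap \mathrm{B}_{\|F(x)\|+\|A^\circ(x)\|}}\langle \xi, v-x^*\rangle\le 0.$$
   Context: $\mathbb{R}^n$ carries its Euclidean inner product $\langle\cdot,\cdot\rangle$ and norm $\|\cdot\|$; $\mathrm{B}_r$ is the closed ball of radius $r$ centered at the origin $\theta$. For a nonempty set $C$: $\|C\|:=\sup\{\|v\|: v\in C\}$; $\Pi_C(x):=\{s\in C:\|x-s\|=d_C(x)\}$ is the projection, $d_C$ being the distance function to $C$. $\mathrm{dom}\,A=\{x: A(x)\ne\emptyset\}$. For $x\in\mathrm{dom}\,A$ the set $A(x)$ is closed and convex, $\Pi_{A(x)}(v)$ is identified with its unique element, and $A^\circ(x):=\Pi_{A(x)}(\theta)$ is the element of minimal norm of $A(x)$. $F$ is an $L$-Lipschitz Cusco mapping if it has nonempty, convex, compact values and $F(x)\subset F(y)+L\|x-y\|\,\mathrm{B}_1$ for all $x,y\in\mathbb{R}^n$. A solution of the differential inclusion is a continuous function $x:[0,\infty)\to\mathbb{R}^n$ that is absolutely continuous on every compact subset of $(0,+\infty)$, with $x(0)=x_0$ and $\dot x(t)\in F(x(t))-A(x(t))$ for a.e. $t\ge0$. A closed set $S$ is strong invariant if for every $x_0\in S\cap\overline{\mathrm{dom}\,A}$ and every solution $x(\cdot;x_0)$ starting at $x_0$ one has $x(t;x_0)\in S$ for all $t\ge0$. For $x\in S$: the proximal normal cone $\mathrm{N}_S^P(x)$ is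 the set of $\xi$ with $\liminf_{y\to x,\,y\in S,\,y\ne x}\frac{-\langle\xi,y-x\rangle}{\|y-x\|^2}>-\infty$; the Fréchet normal cone $\mathrm{N}_S^F(x)$ is the set of $\xi$ with $\liminf_{y\to x,\,y\in S,\,y\neq x}\frac{-\langle\xi,y-x\rangle}{\|y-x\|}\ge0$ (i.e. the proximal and Fréchet subdifferentials at $x$ of the indicator function of $S$). The Bouligand tangent cone is $\mathrm{T}_S^B(x):=\{v\in\mathbb{R}^n:\ \exists x_k\in S,\ \exists t_k>0,\ t_k\to0,\ t_k^{-1}(x_k-x)\to v\}$, and $\overline{\mathrm{co}}$ denotes closed convex hull. *)

(* Defs.v *)
From HB Require Import structures.
From mathcomp Require Import all_boot all_order all_algebra.
From mathcomp Require Import all_classical all_reals all_analysis.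

Set Implicit Arguments.
Unset Strict Implicit.
Unset Printing Implicit Defensive.

Import Order.TTheory GRing.Theory Num.Theory.
Import numFieldNormedType.Exports.

Local Open Scope classical_set_scope.
Local Open Scope ring_scope.

Section Euclidean.
Context {R : realType} {n : nat}.
Local Notation V := 'rV[R]_n.
Implicit Types (x y v : V) (C : set V).

Definition edot x y : R := \sum_i x ord0 i * y ord0 i.

(* The library norm on matrices is the max norm. It has the same topology,
   so only the metric notions below need the Euclidean norm. *)
Definition enorm x : R := Num.sqrt (edot x x).

Definition eball (r : R) : set V := [set x | enorm x <= r].

(* [sup] and [inf] on reals are 0 on sets without a supremum or infimum:
   [norm_set] is meant for nonempty bounded C, [dist_to] for nonempty C. *)
Definition norm_set C : R := sup [set enorm v | v in C].

Definition dist_to C x : R := inf [set enorm (x - s) | s in C].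

Definition proj_set C x : set V := [set s | C s /\ enorm (x - s) = dist_to C x].

(* The element of [proj_set C x] when it is a singleton, e.g. when C is nonempty,
   closed and convex; an arbitrary vector when [proj_set C x] is empty. *)
Definition proj_pt C x : V := get (proj_set C x).

Definition closed_convex_hull C : set V :=
  smallest (fun D : set V => closed D /\ convex_set D) C.

Definition proximal_normal_cone (S : set V) x : set V :=
  [set xi | (-oo < limf_einf
     (fun y => (- edot xi (y - x) / enorm (y - x) ^+ 2)%:E) (within S x^'))%E].

Definition frechet_normal_cone (S : set V) x : set V :=
  [set xi | (0 <= limf_einf
     (fun y => (- edot xi (y - x) / enorm (y - x))%:E) (within S x^'))%E].

Definition bouligand_cone (S : set V) x : set V :=
  [set v | exists (x_ : nat -> V) (t_ : nat -> R),
     [/\ forall k, S (x_ k), forall k, 0 < t_ k, t_ @ \oo --> (0 : R)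
       & (fun k => (t_ k)^-1 *: (x_ k - x)) @ \oo --> v]].

End Euclidean.

Section Inclusion.
Context {R : realType} {n : nat}.
Local Notation V := 'rV[R]_n.
Implicit Types (A F : V -> set V) (S : set V).

Definition op_dom A : set V := [set x | A x !=set0].

Definition monotone_op A : Prop :=
  forall x y xs ys, A x xs -> A y ys -> 0 <= edot (xs - ys) (x - y).

Definition maximal_monotone A : Prop :=
  monotone_op A /\
  forall B, monotone_op B -> (forall x, A x `<=` B x) -> forall x, B x `<=` A x.

Definition min_norm_elt A (x : V) : V := proj_pt (A x) 0.

Definition lipschitz_cusco (L : R) F : Prop :=
  (forall x, [/\ F x !=set0, convex_set (F x) & compact (F x)]) /\
  (forall x y, F x `<=`
     [set w + (L * enorm (x - y)) *: b | w in F y & b in eball 1]).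

(* Finitely many nonoverlapping intervals with endpoints in K; degenerate
   intervals are harmless. *)
Definition abs_continuous_on (K : set R) (x : R -> V) : Prop :=
  forall e : R, 0 < e -> exists2 d : R, 0 < d &
    forall (m : nat) (a b : 'I_m -> R),
      (forall i, [/\ K (a i), K (b i) & a i <= b i]) ->
      trivIset [set: 'I_m] (fun i => `]a i, b i[%classic) ->
      \sum_i (b i - a i) < d ->
      \sum_i enorm (x (b i) - x (a i)) < e.

(* A trajectory on [0, +oo[ is a function on R whose values at negative times
   are irrelevant. *)
Definition is_solution F A (x0 : V) (x : R -> V) : Prop :=
  [/\ {within `[0, +oo[, continuous x},
      forall K : set R, compact K -> K `<=` `]0, +oo[ -> abs_continuous_on K x,
      x 0 = x0
    & {ae (@lebesgue_measure R), forall t : R, 0 <= t ->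
        derivable x t 1 /\
        [set v - a | v in F (x t) & a in A (x t)] (derive1 x t)}].

Definition strong_invariant F A S : Prop :=
  forall x0, (S `&` closure (op_dom A)) x0 ->
  forall x, is_solution F A x0 x -> forall t, 0 <= t -> S (x t).

End Inclusion.

(* Main.v *)
Require Import Defs.
From HB Require Import structures.
From mathcomp Require Import all_boot all_order all_algebra.
From mathcomp Require Import all_classical all_reals all_analysis.
From mathcomp Require Import ring lra.

Set Implicit Arguments.
Unset Strict Implicit.
Unset Printing Implicit Defensive.

Import Order.TTheory GRing.Theory Num.Theory.
Import numFieldNormedType.Exports.

Local Open Scope classical_set_scope.
Local Open Scope ring_scope.

(** The heart of the matter is the equivalence between strong invariance and
    the normal condition (v); the tangential conditions and the other normal
    conditions are tied to it by polarity ([frechet_polar_hull]) and by the norm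
    bound on projections ([proj_pt_norm]).

    From (v) to invariance. Along a trajectory, let [s] be a point of [S]
    nearest to [x t]. Then [x t - s] is a proximal normal at [s]
    ([proj_proximal]), and (v) at [s], the Lipschitz property of [F] and the
    monotonicity of [A] bound the slope of the squared distance to [S] at [t] by
    [2 |L|] times that squared distance
    ([normal_condition_dissipation], [upper_dini_sqr_dist]). The squared
    distance is absolutely continuous and vanishes at time 0, so a Gronwall
    argument, based on a Dini inequality valid outside a null set
    ([ac_dini_le]), keeps it equal to 0.

    From invariance to (ii). It suffices to produce, for [x0] in [S] and in the
    domain of [A] and for [v] in [F x0], one global solution starting at [x0]
    with initial velocity [v - proj_pt (A x0) v]: it stays in [S], so this
    velocity is tangent ([driven_bouligand]). The solution is a limit of the
    implicit Euler scheme, whose steps are solvable by Minty's theorem ([minty]).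
    Instead of a selection of [F], the forcing terms are picked successively,
    each as close to the preceding one as the Lipschitz property allows; this
    bounds the discrete velocities on bounded time intervals. The limit is
    taken pointwise along an ultrafilter on the step numbers, so that every
    bounded sequence converges and every closed inequality passes to the limit
    ([driven_trajectory_exists]).

    It remains to differentiate the limit [x], driven by the Lipschitz forcing
    [w]. Accumulation points of its difference quotients at [t] belong to
    [w t - A (x t)] and, on the right, have norm at most the least norm of that
    closed convex set: the right derivative is [w t - proj_pt (A (x t)) (w t)]
    ([right_velocity]). On bounded intervals its norm is a nonincreasing function
    plus a linear one ([velocity_almost_decreasing]), hence continuous from the
    left at all but countably many times ([countable_left_jumps]), and there the
    left derivative exists and is the same ([two_sided_velocity]). Thus [x] is a
    solution ([driven_is_solution]). *)

(** * Euclidean geometry of row vectors *)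

Section EuclideanSpace.
Context {R : realType} {n : nat}.
Local Notation V := 'rV[R]_n.
Implicit Types (x y z v : V) (C : set V).

Lemma edotC x y : edot x y = edot y x.
Proof. by apply: eq_bigr => i _; rewrite mulrC. Qed.

Lemma edotDl x y z : edot (x + y) z = edot x z + edot y z.
Proof. by rewrite -big_split; apply: eq_bigr => i _; rewrite mxE mulrDl. Qed.

Lemma edotZl (a : R) x y : edot (a *: x) y = a * edot x y.
Proof. by rewrite mulr_sumr; apply: eq_bigr => i _; rewrite mxE mulrA. Qed.

Lemma edotNl x y : edot (- x) y = - edot x y.
Proof. by rewrite -scaleN1r edotZl mulN1r. Qed.

Lemma edotDr x y z : edot z (x + y) = edot z x + edot z y.
Proof. by rewrite edotC edotDl !(edotC z). Qed.

Lemma edotZr (a : R) x y : edot x (a *: y) = a * edot x y.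
Proof. by rewrite edotC edotZl edotC. Qed.

Lemma edotNr x y : edot x (- y) = - edot x y.
Proof. by rewrite edotC edotNl edotC. Qed.

Lemma edot0l x : edot 0 x = 0.
Proof. by rewrite -(scale0r x) edotZl mul0r. Qed.

Lemma edot0r x : edot x 0 = 0.
Proof. by rewrite edotC edot0l. Qed.

Definition edotE := (edotDl, edotDr, edotNl, edotNr, edotZl, edotZr).

Lemma edot_ge0 x : 0 <= edot x x.
Proof. by apply: sumr_ge0 => i _; rewrite -expr2 sqr_ge0. Qed.

Lemma enorm_ge0 x : 0 <= enorm x.
Proof. exact: sqrtr_ge0. Qed.

Lemma enorm_sqr x : enorm x ^+ 2 = edot x x.
Proof. by rewrite sqr_sqrtr// edot_ge0. Qed.

Lemma enorm_le x y : (enorm x <= enorm y) = (edot x x <= edot y y).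
Proof. by rewrite ler_sqrt// edot_ge0. Qed.

Lemma enorm0 : enorm (0 : V) = 0.
Proof. by rewrite /enorm edot0l sqrtr0. Qed.

Lemma enormZ (a : R) x : enorm (a *: x) = `|a| * enorm x.
Proof. by rewrite /enorm !edotE mulrA -expr2 sqrtrM ?sqr_ge0// sqrtr_sqr. Qed.

Lemma enormN x : enorm (- x) = enorm x.
Proof. by rewrite /enorm !edotE opprK. Qed.

Lemma enormBC x y : enorm (x - y) = enorm (y - x).
Proof. by rewrite -enormN opprB. Qed.

Lemma coord_le_enorm x i : `|x ord0 i| <= enorm x.
Proof.
rewrite -sqrtr_sqr ler_sqrt ?edot_ge0// /edot (bigD1 i)//= -expr2 lerDl.
by apply: sumr_ge0 => j _; rewrite -expr2 sqr_ge0.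
Qed.

Lemma mx_norm_le_enorm x : `|x| <= enorm x.
Proof.
rewrite [leLHS]/Num.norm /= mx_normrE; apply/bigmax_leP.
by split=> [|[i j] _] /=; rewrite ?enorm_ge0// ord1 coord_le_enorm.
Qed.

Lemma enorm_eq0 x : enorm x = 0 -> x = 0.
Proof.
move=> x0; apply/eqP; rewrite -normr_le0.
by rewrite (le_trans (mx_norm_le_enorm x)) ?x0.
Qed.

Lemma cauchy_schwarz x y : edot x y <= enorm x * enorm y.
Proof.
have [y0|y0] := eqVneq (enorm y) 0.
  by rewrite y0 mulr0 (enorm_eq0 y0) edot0r.
have [x0|x0] := eqVneq (enorm x) 0.
  by rewrite x0 mul0r (enorm_eq0 x0) edot0l.
have ylt : 0 < enorm y by rewrite lt_def y0 enorm_ge0.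
have xlt : 0 < enorm x by rewrite lt_def x0 enorm_ge0.
have := edot_ge0 (enorm y *: x - enorm x *: y).
rewrite !edotE (edotC y x) -!enorm_sqr => H.
have {}H : 0 <= 2 * (enorm x * enorm y) * (enorm x * enorm y - edot x y).
  apply: le_trans H _; rewrite le_eqVlt; apply/orP; left; apply/eqP; ring.
by rewrite pmulr_rge0 ?subr_ge0// in H; rewrite ?mulr_gt0.
Qed.

Lemma cauchy_schwarzN x y : - edot x y <= enorm x * enorm y.
Proof. by rewrite -edotNl -(enormN x) cauchy_schwarz. Qed.

Lemma enormD x y : enorm (x + y) <= enorm x + enorm y.
Proof.
rewrite -(@ler_pXn2r _ 2)// ?nnegrE ?addr_ge0 ?enorm_ge0//.
rewrite enorm_sqr !edotE (edotC y x) -!enorm_sqr.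
have := cauchy_schwarz x y; lra.
Qed.

Lemma enorm_dist y x z : enorm (x - z) <= enorm (x - y) + enorm (y - z).
Proof. by rewrite -[x - z](subrKA y) enormD. Qed.

Lemma edot_cvg {I} {F : set_system I} {FF : ProperFilter F} (f g : I -> V) x y :
  f @ F --> x -> g @ F --> y -> edot (f i) (g i) @[i --> F] --> edot x y.
Proof.
move=> fx gy; apply: cvg_big => [|j _]; first exact: add_continuous.
apply: cvgM; first apply: (@cvg_comp _ _ _ f (fun M : V => M ord0 j) _ _ _ fx).
  exact: coord_continuous.
apply: (@cvg_comp _ _ _ g (fun M : V => M ord0 j) _ _ _ gy).
exact: coord_continuous.
Qed.

Lemma enorm_cvg {I} {F : set_system I} {FF : ProperFilter F} (f : I -> V) x :
  f @ F --> x -> enorm (f i) @[i --> F] --> enorm x.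
Proof.
move=> fx; apply: (@cvg_comp _ _ _ _ (@Num.sqrt R) _ _ _ (edot_cvg fx fx)).
exact: sqrt_continuous.
Qed.

Lemma cvg_enorm {I} {F : set_system I} {FF : Filter F} (f : I -> V) x :
  (forall e, 0 < e -> \forall i \near F, enorm (x - f i) <= e) -> f @ F --> x.
Proof.
move=> H; apply/cvgrPdist_le => e e0.
by apply: filterS (H e e0) => i; apply: le_trans (mx_norm_le_enorm _).
Qed.

Lemma closed_sublevel (T : topologicalType) (f : T -> R) (r : R) :
  continuous f -> closed [set x | f x <= r].
Proof.
move=> cf; apply: (@preimage_closed _ _ f [set u | u <= r]); last exact: closed_le.
by move=> x _; exact: cf.
Qed.

Lemma enorm_continuous : continuous (@enorm R n).
Proof. by move=> x; apply: (@enorm_cvg _ (nbhs x) _ id x); exact: cvg_id. Qed.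

Lemma enormB_continuous x : continuous (fun y => enorm (x - y)).
Proof.
move=> y; apply: (@enorm_cvg _ (nbhs y) _ (fun y => x - y) (x - y)).
by apply: cvgB; [exact: cvg_cst|exact: cvg_id].
Qed.

Lemma ebounded_closed_compact C (r : R) :
  (forall x, C x -> enorm x <= r) -> closed C -> compact C.
Proof.
move=> Cr; apply: bounded_closed_compact; exists r; split; first exact: num_real.
move=> s rs x /Cr xr /=.
exact: le_trans (mx_norm_le_enorm x) (le_trans xr (ltW rs)).
Qed.

Lemma compact_ebounded C : compact C -> exists r : R, forall x, C x -> enorm x <= r.
Proof.
move=> cC.
have cf : {within C, continuous (@enorm R n)}.
  exact/continuous_subspaceT/enorm_continuous.
have /compact_bounded[M [_ HM]] := continuous_compact cf cC.
exists (M + 1) => x Cx.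
have := HM (M + 1); rewrite ltrDl ltr01 => /(_ isT (enorm x)) h.
by rewrite -(ger0_norm (enorm_ge0 x)); apply: h; exists x.
Qed.

(** Compactness of closed balls, in the form that needs no subsequence: an
    ultrafilter sends a bounded family to an ultrafilter on a ball. *)
Lemma ultra_bounded_cvg {I} (U : set_system I) (f : I -> V) (r : R) :
  UltraFilter U -> (\forall i \near U, enorm (f i) <= r) ->
  exists l : V, f @ U --> l.
Proof.
move=> UU fr.
have Ufm : UltraFilter (f @ U).
  split; first exact: fmap_proper_filter.
  move=> G GP sG; apply/seteqP; split=> // B GB.
  have [//|nB] := @in_ultra_setVsetC I U (f @^-1` B) UU.
  exfalso; have GnB : G (~` B) by apply: sG.
  have [p [Bp nBp]] : (B `&` ~` B) !=set0 by apply: (@filter_ex _ G); apply: filterI.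
  exact: nBp.
have cpt : compact [set x : V | enorm x <= r].
  apply: (@ebounded_closed_compact _ r) => //.
  exact/closed_sublevel/enorm_continuous.
by move: cpt; rewrite compact_ultra => /(_ _ Ufm fr)[l [_ ?]]; exists l.
Qed.

(** * Metric projection *)

Lemma dist_to_le C x y : C y -> dist_to C x <= enorm (x - y).
Proof.
move=> Cy; apply: ge_inf; last by exists y.
by exists 0 => _ [s _ <-]; exact: enorm_ge0.
Qed.

Lemma dist_to_glb C x r : C !=set0 -> (forall y, C y -> r <= enorm (x - y)) ->
  r <= dist_to C x.
Proof.
move=> [y Cy] H; apply: lb_le_inf; first by exists (enorm (x - y)), y.
by move=> _ [s Cs <-]; exact: H.
Qed.

Lemma dist_to_ge0 C x : 0 <= dist_to C x.
Proof.
have [C0|/set0P/negP/negPn/eqP ->] := pselect (C !=set0).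
  by apply: dist_to_glb => // y _; exact: enorm_ge0.
by rewrite /dist_to image_set0 inf0.
Qed.

Lemma closed_proj_set C x : closed C -> C !=set0 -> proj_set C x !=set0.
Proof.
move=> clC [y0 Cy0].
pose D := C `&` [set y | enorm (x - y) <= enorm (x - y0)].
have cD : compact D.
  apply: (@ebounded_closed_compact _ (enorm x + enorm (x - y0))).
    move=> y [_ /= h]; have := enormD x (y - x).
    by rewrite subrKC (enormBC y); lra.
  by apply: closedI => //; exact/closed_sublevel/enormB_continuous.
have [|c /set_mem[Cc cy0] cmin] := compact_EVT_min _ cD
    (continuous_subspaceT (@enormB_continuous x)).
  by exists y0; split => /=.
exists c; split=> //; apply/eqP; rewrite eq_le dist_to_le// andbT.
apply: dist_to_glb; first by exists y0.
move=> y Cy; have [yy|yy] := leP (enorm (x - y)) (enorm (x - y0)).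
  by apply: cmin; apply/mem_set.
by rewrite (le_trans cy0)// ltW.
Qed.

Lemma proj_ptP C x : closed C -> C !=set0 ->
  C (proj_pt C x) /\ forall s, C s -> enorm (x - proj_pt C x) <= enorm (x - s).
Proof.
move=> clC C0; have [Cp Ep] := getPex (closed_proj_set x clC C0).
by split=> // s Cs; rewrite Ep dist_to_le.
Qed.

(** Convexity with plain scalar coefficients in place of bundled ones. *)
Definition segment_convex C := forall s s' (a : R), C s -> C s' ->
  0 <= a -> a <= 1 -> C (s + a *: (s' - s)).

(** First-order optimality: moving from the nearest point [p] towards [s] by a
    small step cannot decrease the distance to [x]. *)
Lemma proj_obtuse C x p : segment_convex C -> C p ->
  (forall s, C s -> enorm (x - p) <= enorm (x - s)) ->
  forall s, C s -> edot (x - p) (s - p) <= 0.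
Proof.
move=> cvxC Cp pmin s Cs; rewrite leNgt; apply/negP => pos.
have n0 := edot_ge0 (s - p).
have bq : 0 < edot (x - p) (s - p) + edot (s - p) (s - p) by rewrite ltr_pwDl.
have [a [a0 a1 Ea]] : exists a, [/\ 0 < a, a <= 1 &
    a * (edot (x - p) (s - p) + edot (s - p) (s - p)) = edot (x - p) (s - p)].
  (* any step below twice the minimiser of the quadratic in [a] works; this one
     is also at most 1 *)
  exists (edot (x - p) (s - p) / (edot (x - p) (s - p) + edot (s - p) (s - p))).
  split; first by rewrite divr_gt0.
    by rewrite ler_pdivrMr// mul1r lerDl.
  by rewrite divfK// gt_eqF.
have := pmin _ (cvxC _ _ a Cp Cs (ltW a0) a1).
rewrite enorm_le opprD addrA.
move: (x - p) (s - p) pos n0 bq Ea => u w pos n0 bq Ea.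
rewrite !edotE (edotC w u) => h.
have {}h : 2 * a * edot u w <= a * (a * edot w w) by lra.
have {}h : 2 * edot u w <= a * edot w w by rewrite -(ler_pM2l a0); lra.
have : 0 < a * edot u w by rewrite mulr_gt0.
by move: Ea; rewrite mulrDr; lra.
Qed.

Lemma proj_pt_unique C x s : closed C -> segment_convex C -> C s ->
  enorm (x - s) <= enorm (x - proj_pt C x) -> s = proj_pt C x.
Proof.
move=> clC cvxC Cs; have [|Cp pmin] := @proj_ptP C x clC; first by exists s.
move: (proj_obtuse cvxC Cp pmin Cs) => + le_s.
move: le_s; rewrite enorm_le.
rewrite -[s in x - s](subrKC (proj_pt C x)) opprD addrA.
move=> h1 h2; apply/eqP; rewrite -subr_eq0; apply/eqP/enorm_eq0.
move: (x - _) (s - _) h1 h2 => u w; rewrite !edotE (edotC w u) => h1 h2.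
apply/eqP; rewrite -sqrf_eq0 enorm_sqr; apply/eqP.
by have := edot_ge0 w; lra.
Qed.

(** Nonexpansiveness of the projection, applied to [x] and the origin. *)
Lemma proj_pt_norm C x : closed C -> segment_convex C -> C !=set0 ->
  enorm (proj_pt C x) <= enorm x + enorm (proj_pt C 0).
Proof.
move=> clC cvxC C0.
have [Cp pmin] := @proj_ptP C x clC C0; have [C0' p0min] := @proj_ptP C 0 clC C0.
have h1 := proj_obtuse cvxC Cp pmin C0'.
have h2 := proj_obtuse cvxC C0' p0min Cp.
move: (proj_pt C x) (proj_pt C 0) h1 h2 {Cp pmin C0' p0min} => p q h1 h2.
have h3 : enorm (p - q) <= enorm x.
  have [->|pq] := eqVneq (enorm (p - q)) 0; first exact: enorm_ge0.
  have pq0 : 0 < enorm (p - q) by rewrite lt_def pq enorm_ge0.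
  rewrite -(ler_pM2r pq0) -expr2 (le_trans _ (cauchy_schwarz _ _))//.
  rewrite enorm_sqr; move: h1 h2; rewrite !edotE !edot0l (edotC q p); lra.
by have := enormD (p - q) q; rewrite subrK; lra.
Qed.

End EuclideanSpace.

(** * Maximal monotone operators and Minty's theorem *)

Section MaximalMonotone.
Context {R : realType} {n : nat}.
Local Notation V := 'rV[R]_n.
Implicit Types (x y z v a b : V) (A M : V -> set V).

(** The form in which maximality is used: a pair in monotone relation with the
    whole graph belongs to it, since adjoining it keeps the graph monotone. *)
Lemma maximal_mem A x a : maximal_monotone A ->
  (forall y b, A y b -> 0 <= edot (a - b) (x - y)) -> A x a.
Proof.
move=> [mA maxA] h.
apply: (maxA (fun z c => A z c \/ (z = x /\ c = a))); last by right.
  move=> y z b c [Ayb|[-> ->]] [Azc|[-> ->]].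
  - exact: mA.
  - rewrite -[b - a]opprB -[y - x]opprB edotNl edotNr opprK; exact: h.
  - exact: h.
  - by rewrite !subrr edot0l.
by move=> y b Ayb; left.
Qed.

Lemma maximal_closed_value A x : maximal_monotone A -> closed (A x).
Proof.
move=> hA.
have -> : A x = \bigcap_(p in [set p : V * V | A p.1 p.2])
    [set a | edot (p.2 - a) (x - p.1) <= 0].
  apply/seteqP; split=> [a Aa [y b] /= Ab|a h].
    by have [mA _] := hA; have := mA _ _ _ _ Aa Ab; rewrite !edotE; lra.
  by apply: maximal_mem => // y b Ab; have := h (y, b) Ab; rewrite /= !edotE; lra.
apply: closed_bigI => -[y b] _ /=; apply: closed_sublevel => a.
apply: (@edot_cvg _ _ _ (nbhs a) _ (fun a => b - a) (fun=> x - y)).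
  by apply: cvgB; [exact: cvg_cst|exact: cvg_id].
exact: cvg_cst.
Qed.

Lemma maximal_convex_value A x : maximal_monotone A -> segment_convex (A x).
Proof.
move=> hA s s' t As As' t0 t1; apply: maximal_mem => // y b Ab.
have [mA _] := hA; have h := mA _ _ _ _ As Ab; have h' := mA _ _ _ _ As' Ab.
have -> : s + t *: (s' - s) - b = (1 - t) *: (s - b) + t *: (s' - b).
  rewrite scalerBl scale1r !scalerBr; apply/rowP => i; rewrite !mxE; ring.
by rewrite edotDl !edotZl addr_ge0// mulr_ge0// subr_ge0.
Qed.

Lemma le0_of_le_small (e d : R) : (forall t, 0 < t -> t < 1 -> e <= t * d) -> e <= 0.
Proof.
move=> h; rewrite leNgt; apply/negP => e0.
have h2 : e <= 2^-1 * d by apply: h; lra.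
have d0 : 0 < d by lra.
have := h (e / (2 * d)); rewrite divr_gt0 ?mulr_gt0// => /(_ isT).
rewrite ltr_pdivrMr ?mulr_gt0// mul1r => /(_ ltac:(lra)).
have -> : e / (2 * d) * d = e / 2 by field; rewrite gt_eqF.
by lra.
Qed.

(** The affine function of [(x, a)] whose supremum over the graph points [(y, b)]
    is the Fitzpatrick function, plus half the squared norm of [(x, a)]. *)
Definition fitz (y b x a : V) : R :=
  edot x b + edot a y - edot y b + (edot x x + edot a a) / 2.

(** Minty's theorem. With [x, a] minimising the Fitzpatrick function of the
    graph plus half the squared norm, first-order optimality and maximality
    put [(- a, - x)] in the graph, and force [a = - x]. *)
Lemma minty M : monotone_op M ->
  (forall x a, (forall y b, M y b -> 0 <= edot (a - b) (x - y)) -> M x a) ->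
  exists x, M x (- x).
Proof.
move=> mM maxM.
have [[y0 b0] /= M0] : exists p : V * V, M p.1 p.2.
  apply: contrapT => nM; apply: (nM); exists (0, 0) => /=.
  by apply: maxM => y b Mb; exfalso; apply: nM; exists (y, b).
pose K c := [set p : V * V | forall y b, M y b -> fitz y b p.1 p.2 <= c].
have fitz_coercive y b x a :
    fitz y b x a = (edot (x + b) (x + b) + edot (a + y) (a + y)
                    - edot (y + b) (y + b)) / 2.
  by rewrite /fitz !edotE (edotC b x) (edotC y a) (edotC b y); field.
(* monotonicity makes the Fitzpatrick function equal to [edot y b] on the graph *)
have Kgraph y b : M y b -> K (edot y b + (edot y y + edot b b) / 2) (y, b).
  move=> Mb y' b' Mb' /=; have := mM _ _ _ _ Mb Mb'.
  by rewrite /fitz !edotE (edotC b y) (edotC b' y) (edotC b' y'); lra.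
pose E := [set c | K c !=set0].
have Elb : lbound E (- edot (y0 + b0) (y0 + b0) / 2).
  move=> c [[x a] /(_ _ _ M0)]; rewrite fitz_coercive /=.
  by have := edot_ge0 (x + b0); have := edot_ge0 (a + y0); lra.
have E0 : E !=set0 by exists (edot y0 b0 + (edot y0 y0 + edot b0 b0) / 2), (y0, b0); exact: Kgraph.
have hE : has_inf E by split=> //; exists (- edot (y0 + b0) (y0 + b0) / 2).
pose c0 := inf E.
have [[x0 a0] Kz] : K c0 !=set0.
  have /choice[z Kz] (k : nat) : exists p, K (c0 + k.+1%:R^-1) p.
    have [|c [z Kcz] clt] := inf_adherent (eps := k.+1%:R^-1) _ hE.
      by rewrite invr_gt0.
    by exists z => y b Mb; rewrite (le_trans (Kcz _ _ Mb))// ltW.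
  have [U [UU sU]] := ultraFilterLemma eventually_filter.
  have zb k : edot ((z k).1 + b0) ((z k).1 + b0) + edot ((z k).2 + y0) ((z k).2 + y0)
      <= 2 * (c0 + 1) + edot (y0 + b0) (y0 + b0).
    have := Kz k _ _ M0; rewrite fitz_coercive.
    have : (k.+1%:R^-1 : R) <= 1 by rewrite invf_le1 ?ler1n.
    by move: (_^-1) => e; lra.
  have bound (f : nat -> V) (u : V) (B : R) : (forall k, edot (f k + u) (f k + u) <= B) ->
      exists l : V, f @ U --> l.
    move=> fB; apply: (@ultra_bounded_cvg _ _ _ _ _ (1 + B + enorm u)).
    apply: nearW => k; have := enormD (f k + u) (- u); rewrite addrK enormN.
    suff : enorm (f k + u) <= 1 + B by lra.
    have := fB k; rewrite -enorm_sqr; have := enorm_ge0 (f k + u).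
    by move: (enorm _) => e e0 eB; nra.
  have [k|x0 zx] := bound (fun k => (z k).1) b0 (2 * (c0 + 1) + edot (y0 + b0) (y0 + b0)).
    by have := zb k; have := edot_ge0 ((z k).2 + y0); lra.
  have [k|a0 za] := bound (fun k => (z k).2) y0 (2 * (c0 + 1) + edot (y0 + b0) (y0 + b0)).
    by have := zb k; have := edot_ge0 ((z k).1 + b0); lra.
  exists (x0, a0) => y b Mb /=.
  have cvgE : c0 + k.+1%:R^-1 @[k --> U] --> c0 + 0.
    by apply: cvgD; [exact: cvg_cst|apply: cvg_trans (@cvg_harmonic R); exact: cvg_fmap2].
  have cvgF : fitz y b (z k).1 (z k).2 @[k --> U] --> fitz y b x0 a0.
    apply: cvgD; last by apply: cvgM; [apply: cvgD; exact: edot_cvg|exact: cvg_cst].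
    apply: cvgB; last exact: cvg_cst.
    by apply: cvgD; apply: edot_cvg => //; exact: cvg_cst.
  rewrite -[c0]addr0; apply: ler_cvg_to cvgF cvgE _.
  by apply: nearW => k; exact: Kz.
(* the objective is the supremum of quadratics with unit Hessian, so it grows at
   least like half the squared distance to its minimiser *)
have opt y b : M y b ->
    c0 + (edot (y - x0) (y - x0) + edot (b - a0) (b - a0)) / 2
    <= edot y b + (edot y y + edot b b) / 2.
  move=> Mb; rewrite -subr_le0.
  apply: (@le0_of_le_small _ ((edot (y - x0) (y - x0) + edot (b - a0) (b - a0)) / 2)) => t t0 t1.
  have : E ((1 - t) * c0 + t * (edot y b + (edot y y + edot b b) / 2)
      - t * (1 - t) * ((edot (y - x0) (y - x0) + edot (b - a0) (b - a0)) / 2)).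
    exists (x0 + t *: (y - x0), a0 + t *: (b - a0)) => y' b' Mb' /=.
    have h1 : fitz y' b' x0 a0 <= c0 by exact: Kz.
    have h2 := Kgraph _ _ Mb _ _ Mb'.
    have -> : fitz y' b' (x0 + t *: (y - x0)) (a0 + t *: (b - a0)) =
        (1 - t) * fitz y' b' x0 a0 + t * fitz y' b' y b -
        t * (1 - t) * ((edot (y - x0) (y - x0) + edot (b - a0) (b - a0)) / 2).
      by rewrite /fitz !edotE (edotC y x0) (edotC b a0); field.
    rewrite lerD2r lerD// ler_pM2l//; lra.
  move=> /(ge_inf _) => /(_ (ex_intro _ _ Elb)) h.
  rewrite -(ler_pM2l t0); move: h; rewrite -/c0; lra.
(* the Fitzpatrick function of a maximal operator dominates the pairing *)
have low : edot x0 a0 + (edot x0 x0 + edot a0 a0) / 2 <= c0.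
  rewrite leNgt; apply/negP => lt0.
  have gt y b : M y b -> 0 < edot (a0 - b) (x0 - y).
    move=> Mb; have := Kz _ _ Mb; rewrite /fitz /= !edotE (edotC a0 x0) (edotC b x0) (edotC b y).
    by move: lt0; lra.
  have M00 : M x0 a0 by apply: maxM => y b /gt /ltW.
  by have := gt _ _ M00; rewrite !subrr edot0l ltxx.
have key y b : M y b -> edot (x0 + a0) (x0 + a0) <= edot (b + x0) (a0 + y).
  move=> /opt; move: low; rewrite !edotE.
  by rewrite (edotC y x0) (edotC b a0) (edotC a0 x0) (edotC b y); lra.
have Mm : M (- a0) (- x0).
  apply: maxM => y b /key; have := edot_ge0 (x0 + a0).
  by rewrite -opprD -opprD edotNl edotNr opprK (addrC x0 b); lra.
have := key _ _ Mm; rewrite addNr edot0l => h.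
have xa : x0 + a0 = 0.
  apply/enorm_eq0/eqP; rewrite -sqrf_eq0 enorm_sqr; apply/eqP/le_anti.
  by rewrite h edot_ge0.
by exists x0; move: Mm; rewrite -(eqP (_ : x0 == - a0)) // -addr_eq0 xa.
Qed.

(** Minty's theorem for [A], scaled by [h] and translated by [z]: the implicit Euler
    step from [z] can be made. *)
Lemma resolvent A (h : R) z : maximal_monotone A -> 0 < h ->
  exists x, A x (h^-1 *: (z - x)).
Proof.
move=> hA h0.
have [|x a|x Ax] := @minty (fun x a => A x (h^-1 *: (z + a))); last by exists x.
  have [mA _] := hA; move=> x y a b Aa Ab.
  have := mA _ _ _ _ Aa Ab; rewrite -scalerBr edotZl pmulr_rge0 ?invr_gt0//.
  by rewrite opprD addrACA subrr add0r.
move=> H; apply: maximal_mem => // y b Ab.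
have /H : A y (h^-1 *: (z + (h *: b - z))).
  by rewrite subrKC scalerA mulVf ?gt_eqF// scale1r.
have -> : h^-1 *: (z + a) - b = h^-1 *: (a - (h *: b - z)).
  apply/rowP => i; rewrite !mxE; field; rewrite gt_eqF//.
by rewrite edotZl => ?; rewrite mulr_ge0// invr_ge0 ltW.
Qed.

End MaximalMonotone.

(** * Normal and tangent cones *)

Section Cones.
Context {R : realType} {n : nat}.
Local Notation V := 'rV[R]_n.
Implicit Types (x y z v xi : V) (S : set V).

Lemma enorm_gt0 x : (0 < enorm x) = (x != 0).
Proof.
rewrite lt_def enorm_ge0 andbT; congr negb; apply/eqP/eqP => [/enorm_eq0//|->].
exact: enorm0.
Qed.

(** A lower limit that is not [-oo] becomes a local quadratic bound once
    denominators are cleared; at [y = x] that bound is trivial, so the puncture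
    of the neighbourhood can be forgotten. *)
Lemma proximal_normalP S x xi : proximal_normal_cone S x xi <->
  exists M : R, \forall y \near x, S y ->
    edot xi (y - x) <= M * enorm (y - x) ^+ 2.
Proof.
rewrite /proximal_normal_cone /= limf_einfE; split=> [/ereal_sup_gt|[M h]].
  move=> [_ [W FW <-] lt].
  have {}FW : \forall y \near x, y != x -> S y -> W y by exact: FW.
  have [M Mlt] : exists M : R, (M%:E <= ereal_inf
      ((fun y => (- edot xi (y - x) / enorm (y - x) ^+ 2)%:E) @` W))%E.
    by move: lt; case: ereal_inf => [r _|_|//]; [exists r|exists 0; rewrite leey].
  exists (- M); apply: filterS FW => y FW Sy.
  have [->|yx] := eqVneq y x; first by rewrite subrr edot0r enorm0 expr0n mulr0.
  have := le_trans Mlt (ereal_inf_lbound (imageP _ (FW yx Sy))).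
  by rewrite lee_fin ler_pdivlMr ?exprn_gt0 ?enorm_gt0 ?subr_eq0//; lra.
apply: (@lt_le_trans _ _ (- M)%:E); first by rewrite ltNyr.
pose W := [set y | y != x /\ edot xi (y - x) <= M * enorm (y - x) ^+ 2].
have FW : within S x^' W by apply: filterS h => y h yx Sy; split=> //; exact: h.
apply: le_trans (ereal_sup_ubound (imageP _ FW)).
apply/ereal_infP => _ [y [yx /= hy] <-].
by rewrite lee_fin ler_pdivlMr ?exprn_gt0 ?enorm_gt0 ?subr_eq0//; lra.
Qed.

(** As for proximal normals, with a bound that is little-o of the distance. *)
Lemma frechet_normalP S x xi : frechet_normal_cone S x xi <->
  forall e : R, 0 < e -> \forall y \near x, S y ->
    edot xi (y - x) <= e * enorm (y - x).
Proof.
rewrite /frechet_normal_cone /= limf_einfE; split=> [h e e0|h].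
  have : ((- e)%:E < ereal_sup [set ereal_inf
      ((fun y => (- edot xi (y - x) / enorm (y - x))%:E) @` W) | W in within S x^'])%E.
    by apply: lt_le_trans h; rewrite lte_fin oppr_lt0.
  move=> /ereal_sup_gt[_ [W FW <-] lt].
  have {}FW : \forall y \near x, y != x -> S y -> W y by exact: FW.
  apply: filterS FW => y FW Sy.
  have [->|yx] := eqVneq y x; first by rewrite subrr edot0r enorm0 mulr0.
  have := lt_le_trans lt (ereal_inf_lbound (imageP _ (FW yx Sy))).
  by rewrite lte_fin ltr_pdivlMr ?enorm_gt0 ?subr_eq0//; lra.
apply/lee_addgt0Pr => e e0; rewrite addeC -leeBlDl// sub0e -EFinN.
pose W := [set y | y != x /\ edot xi (y - x) <= e * enorm (y - x)].
have FW : within S x^' W by apply: filterS (h e e0) => y {}h yx Sy; split=> //; exact: h.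
apply: le_trans (ereal_sup_ubound (imageP _ FW)).
apply/ereal_infP => _ [y [yx /= hy] <-].
by rewrite lee_fin ler_pdivlMr ?enorm_gt0 ?subr_eq0//; lra.
Qed.

Lemma near_enorm_lt x (e : R) : 0 < e -> \forall y \near x, enorm (y - x) < e.
Proof.
move=> e0; have : enorm (x - y) @[y --> x] --> enorm (x - x) by exact: enormB_continuous.
rewrite subrr enorm0 => /cvgrPdist_lt/(_ e e0); apply: filterS => y.
by rewrite sub0r normrN ger0_norm ?enorm_ge0// enormBC.
Qed.

Lemma proximal_sub_frechet S x : proximal_normal_cone S x `<=` frechet_normal_cone S x.
Proof.
move=> xi /proximal_normalP[M h]; apply/frechet_normalP => e e0.
have M0 : 0 < `|M| + 1 by rewrite ltr_wpDl.
have := near_enorm_lt x (divr_gt0 e0 M0).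
apply: filterS2 h => y h; rewrite ltr_pdivlMr// => lt Sy.
apply: le_trans (h Sy) _; rewrite expr2 mulrA ler_wpM2r ?enorm_ge0//.
have := ler_norm M; have := enorm_ge0 (y - x); move: lt.
by move: (enorm _) (`|M|) => d m; nra.
Qed.

(** The nearest point property makes [z - s] proximal: the squared distance to
    [z] is minimal over [S] at [s]. *)
Lemma proj_proximal S z s : proj_set S z s -> proximal_normal_cone S s (z - s).
Proof.
move=> [Ss ds]; apply/proximal_normalP; exists 2^-1; apply: (@nearW _ (nbhs s)) => y Sy.
have := dist_to_le z Sy; rewrite -ds enorm_le enorm_sqr.
have -> : z - y = (z - s) - (y - s) by rewrite opprB addrA subrK.
move: (z - s) (y - s) => u w; rewrite !edotE (edotC w u); lra.
Qed.

(** Apply the little-o bound along the approximating sequence and divide by the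
    step sizes. *)
Lemma frechet_polar_bouligand S x xi v :
  frechet_normal_cone S x xi -> bouligand_cone S x v -> edot xi v <= 0.
Proof.
move=> /frechet_normalP h [x_ [t_ [Sx t0 tc vc]]].
have xc : x_ @ \oo --> x.
  have -> : x_ = (fun k => t_ k *: ((t_ k)^-1 *: (x_ k - x)) + x).
    by apply/funext => k; rewrite scalerA divff ?gt_eqF// scale1r subrK.
  rewrite -[x in _ --> x]add0r -[0](scale0r v).
  by apply: cvgD; [apply: cvgZ|exact: cvg_cst].
have le (e : R) : 0 < e -> edot xi v <= e * enorm v.
  move=> e0; have near_k : \forall k \near \oo, S (x_ k) ->
      edot xi (x_ k - x) <= e * enorm (x_ k - x) by exact: xc _ (h e e0).
  have c1 : edot xi ((t_ k)^-1 *: (x_ k - x)) @[k --> \oo] --> edot xi v.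
    by apply: edot_cvg => //; exact: cvg_cst.
  have c2 : e * enorm ((t_ k)^-1 *: (x_ k - x)) @[k --> \oo] --> e * enorm v.
    by apply: cvgM; [exact: cvg_cst|exact: enorm_cvg].
  apply: ler_cvg_to c1 c2 _; apply: filterS near_k => k /(_ (Sx k)) hk.
  by rewrite edotZr enormZ mulrCA gtr0_norm ?invr_gt0// ler_pM2l ?invr_gt0.
by apply: (@le0_of_le_small _ _ (enorm v)) => t /le.
Qed.

(** A half-space is closed and convex, so polarity passes to the hull. *)
Lemma frechet_polar_hull S x xi v :
  frechet_normal_cone S x xi -> closed_convex_hull (bouligand_cone S x) v ->
  edot xi v <= 0.
Proof.
move=> hxi /(_ [set w | edot xi w <= 0]); apply; split; last first.
  by move=> w; exact: frechet_polar_bouligand.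
split.
  apply: closed_sublevel => w.
  by apply: (@edot_cvg _ _ _ (nbhs w) _ (fun=> xi) id); [exact: cvg_cst|exact: cvg_id].
move=> y z k /set_mem/= hy /set_mem/= hz; apply/mem_set => /=.
have k0 : 0 <= k%:num by []. have k1 : k%:num <= 1 by [].
rewrite -[conv _ _ _]/(k%:num *: y + (1 - k%:num) *: z) edotDr !edotZr.
by nra.
Qed.

End Cones.

(** * The implicit Euler scheme *)

Section ImplicitEuler.
Context {R : realType} {n : nat}.
Local Notation V := 'rV[R]_n.
Implicit Types (x y v w a b : V) (A F : V -> set V).

Lemma enorm_le_of_sqr_le x (c : R) : 0 <= c -> edot x x <= c * enorm x -> enorm x <= c.
Proof.
move=> c0; rewrite -enorm_sqr; have := enorm_ge0 x.
by move: (enorm x) => e e0 h; rewrite leNgt; apply/negP => ce; nra.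
Qed.

(** Monotonicity at the two new points, paired with their difference, and the
    Cauchy-Schwarz inequality. *)
Lemma implicit_step_contraction A (h : R) x x' w y y' b : monotone_op A -> 0 < h ->
  A x' (w - h^-1 *: (x' - x)) -> A y' (b - h^-1 *: (y' - y)) ->
  enorm (x' - y') <= enorm (x - y) + h * enorm (w - b).
Proof.
move=> mA h0 Ax Ay; have := mA _ _ _ _ Ax Ay.
have -> : w - h^-1 *: (x' - x) - (b - h^-1 *: (y' - y)) =
    h^-1 *: (h *: (w - b) - (x' - y') + (x - y)).
  by apply/rowP => i; rewrite !mxE; field; rewrite gt_eqF.
rewrite edotZl pmulr_rge0 ?invr_gt0//.
move: (x' - y') (x - y) (w - b) => p u q H.
apply: enorm_le_of_sqr_le; first by rewrite addr_ge0 ?mulr_ge0 ?enorm_ge0 ?ltW.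
have := cauchy_schwarz u p; have := cauchy_schwarz q p; move: H.
rewrite !edotE mulrDl => H h1 h2.
have : h * edot q p <= h * (enorm q * enorm p) by rewrite ler_pM2l.
by lra.
Qed.

(** The forcing terms [W k] are not the values of a selection of [F]: each is
    picked in view of the preceding one, so that their increments are controlled
    by those of [X]. *)
Definition euler_scheme A F (L h : R) (X W : nat -> V) : Prop :=
  [/\ forall k, F (X k) (W k),
      forall k, A (X k.+1) (W k - h^-1 *: (X k.+1 - X k))
    & forall k, enorm (W k.+1 - W k) <= L * enorm (X k.+1 - X k)].

Lemma lipschitz_cusco_near F (L : R) x y v : lipschitz_cusco L F -> F x v ->
  exists2 w, F y w & enorm (w - v) <= `|L| * enorm (y - x).
Proof.
move=> [_ lF] /(lF x y)[w Fw [u /= u1 <-]]; exists w => //.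
rewrite opprD addNKr enormN enormZ normrM (ger0_norm (enorm_ge0 _)) enormBC.
by rewrite -[leRHS]mulr1 ler_wpM2l// mulr_ge0// enorm_ge0.
Qed.

Lemma euler_scheme_exists A F (L h : R) x0 v : maximal_monotone A ->
  lipschitz_cusco L F -> 0 < h -> F x0 v ->
  exists X W, [/\ X 0%N = x0, W 0%N = v & euler_scheme A F `|L| h X W].
Proof.
move=> hA hF h0 Fv.
have /choice[g gP] (p : V * V) : exists q : V * V, F p.1 p.2 ->
    [/\ F q.1 q.2, A q.1 (p.2 - h^-1 *: (q.1 - p.1))
      & enorm (q.2 - p.2) <= `|L| * enorm (q.1 - p.1)].
  have [x' Ax'] := resolvent (p.1 + h *: p.2) hA h0.
  have [Fp|nFp] := pselect (F p.1 p.2); last by exists p => /nFp.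
  have [w Fw ww] := lipschitz_cusco_near x' hF Fp.
  exists (x', w) => _; split=> //=; move: Ax'; congr (A _ _).
  by apply/rowP => i; rewrite !mxE; field; rewrite gt_eqF.
pose Z k := iter k g (x0, v).
have FZ k : F (Z k).1 (Z k).2 by elim: k => [//|k /gP[]].
exists (fun k => (Z k).1), (fun k => (Z k).2); split=> //.
by split=> // k; have [] := gP _ (FZ k).
Qed.

Section Estimates.
Context {A F : V -> set V} {L h T C : R} {X W : nat -> V}.
Context (mA : monotone_op A) (L0 : 0 <= L) (h0 : 0 < h) (C0 : 0 <= C).
Context (sch : euler_scheme A F L h X W).

Let stepA k : A (X k.+1) (W k - h^-1 *: (X k.+1 - X k)).
Proof. by case: sch. Qed.

(** The increments of [X] grow by a factor at most [1 + L * h] per step: the step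
    is a contraction and the forcing varies by at most [L] times the last
    increment. The first increment is compared with the rest point obtained by
    replacing the forcing [W 0] by [a]. *)
Lemma euler_speed a k : A (X 0%N) a ->
  enorm (X k.+1 - X k) <= expR (L * (k%:R * h)) * enorm (W 0%N - a) * h.
Proof.
move=> Aa; have [_ _ dW] := sch.
have e0 : 0 <= enorm (W 0%N - a) * h by rewrite mulr_ge0 ?enorm_ge0// ltW.
rewrite -mulrA; elim: k => [|k IH].
  rewrite mul0r mulr0 expR0 mul1r.
  have A0 : A (X 0%N) (a - h^-1 *: (X 0%N - X 0%N)) by rewrite subrr scaler0 subr0.
  have := implicit_step_contraction mA h0 (stepA 0) A0.
  by rewrite subrr enorm0 add0r mulrC.
have := implicit_step_contraction mA h0 (stepA k.+1) (stepA k).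
have hW : h * enorm (W k.+1 - W k) <= h * (L * enorm (X k.+1 - X k)).
  by rewrite ler_pM2l.
have -> : expR (L * (k.+1%:R * h)) = expR (L * h) * expR (L * (k%:R * h)).
  by rewrite -expRD -addn1 natrD; congr expR; ring.
have e1 : 1 + L * h <= expR (L * h) by exact: expR_ge1Dx.
have hL : 0 <= L * h by rewrite mulr_ge0// ltW.
move: hW e1; have := expR_ge0 (L * (k%:R * h)); have := enorm_ge0 (X k.+1 - X k).
move: IH; move: (enorm (X k.+1 - X k)) (expR (L * h)) (expR (L * (_ * _))).
move: (enorm (W 0%N - a) * h) e0 => E E0 d p q dq d0 q0 hW pL H.
have : (1 + L * h) * d <= p * (q * E) by rewrite ler_pM// addr_ge0.
by rewrite -mulrA; lra.
Qed.

Context (speed : forall k, k%:R * h <= T -> enorm (X k.+1 - X k) <= C * h).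

Lemma euler_lipschitz i j : i%:R * h <= T -> j%:R * h <= T ->
  enorm (X i - X j) <= C * `|i%:R * h - j%:R * h| /\
  enorm (W i - W j) <= L * C * `|i%:R * h - j%:R * h|.
Proof.
wlog ji : i j / (j <= i)%N => [H iT jT|].
  have [/H|/ltnW/H] := leqP j i; first exact.
  by rewrite (enormBC (X i)) (enormBC (W i)) (distrC (i%:R * h)); apply.
rewrite -(subnK ji); move: (i - j)%N => m {ji i} + jT.
elim: m => [_|m IH mT]; first by rewrite add0n !subrr normr0 !mulr0 enorm0.
have {}mT : (m + j)%:R * h <= T.
  by apply: le_trans mT; rewrite ler_pM2r// ler_nat addSn.
have [IX IW] := IH mT; have [_ _ /(_ (m + j)%N) dW] := sch.
have dX := speed mT.
have E k : `|(k + j)%:R * h - j%:R * h| = k%:R * h.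
  by rewrite -mulrBl natrD addrK ger0_norm// mulr_ge0// ltW.
rewrite E; rewrite E in IX IW; rewrite addSn -[m.+1]addn1 natrD mulrDl mul1r.
split.
  by apply: le_trans (enorm_dist (X (m + j)) _ _) _; lra.
apply: le_trans (enorm_dist (W (m + j)) _ _) _.
have : L * enorm (X (m + j).+1 - X (m + j)) <= L * (C * h) by rewrite ler_wpM2l.
by lra.
Qed.

(** A graph point [(y, b)] is at rest under the forcing [b]; the scheme is compared
    with this rest point. *)
Lemma euler_fixed_point i m y b : A y b -> (m + i)%:R * h <= T ->
  enorm (X (m + i) - y) <=
  enorm (X i - y) + m%:R * h * (enorm (W i - b) + L * C * (m%:R * h)).
Proof.
move=> Ab; elim: m => [_|m IH mT]; first by rewrite add0n !mul0r addr0.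
have {}mT : (m + i)%:R * h <= T.
  by apply: le_trans mT; rewrite ler_pM2r// ler_nat addSn.
have A0 : A y (b - h^-1 *: (y - y)) by rewrite subrr scaler0 subr0.
have := implicit_step_contraction mA h0 (stepA (m + i)) A0.
have iT : i%:R * h <= T.
  by apply: le_trans mT; rewrite ler_pM2r// ler_nat leq_addl.
have [_] := euler_lipschitz mT iT.
rewrite -mulrBl natrD addrK ger0_norm; last by rewrite mulr_ge0// ltW.
have := enorm_dist (W i) (W (m + i)) b.
move: (IH mT); rewrite addSn -[m.+1]addn1 natrD.
have LC : 0 <= L * C by rewrite mulr_ge0.
have m0 : 0 <= m%:R :> R by [].
move: (L * C) (m%:R : R) LC m0 => c r c0 r0 {}IH H1 H2 H3.
have H4 : h * enorm (W (m + i) - b) <= h * (c * (r * h) + enorm (W i - b)).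
  by rewrite ler_pM2l//; lra.
have H5 : 0 <= c * h * h * (r + 1) by rewrite !mulr_ge0 ?addr_ge0// ltW.
by lra.
Qed.

(** Comparison of the scheme with a time-shifted copy of itself, whose forcing
    differs by at most the Lipschitz bound for the shift [p]. *)
Lemma euler_shift j p m : (m + (p + j))%:R * h <= T ->
  enorm (X (m + (p + j)) - X (m + j)) <=
  enorm (X (p + j) - X j) + m%:R * h * (L * C * (p%:R * h)).
Proof.
elim: m => [_|m IH mT]; first by rewrite !add0n !mul0r addr0.
have {}mT : (m + (p + j))%:R * h <= T.
  by apply: le_trans mT; rewrite ler_pM2r// ler_nat addSn.
have := implicit_step_contraction mA h0 (stepA (m + (p + j))) (stepA (m + j)).
have jT : (m + j)%:R * h <= T.
  by apply: le_trans mT; rewrite ler_pM2r// ler_nat leq_add2l leq_addl.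
have [_] := euler_lipschitz mT jT.
have E : (m + (p + j))%:R - (m + j)%:R = p%:R :> R by rewrite addnCA natrD addrK.
rewrite -mulrBl E ger0_norm; last by rewrite mulr_ge0// ltW.
move: (IH mT); rewrite !addSn -[m.+1]addn1 natrD => {}IH H1 H2.
have : h * enorm (W (m + (p + j)) - W (m + j)) <= h * (L * C * (p%:R * h)).
  by rewrite ler_pM2l.
by lra.
Qed.

(** The energy inequality, by which the limit will be recognised as a solution.
    In the error constant, [C * T + enorm (X 0%N - y)] bounds [enorm (X k - y)] and
    [L * C * T + enorm (W 0%N - b)] bounds [enorm (W k - b)]. *)
Lemma euler_energy i m y b : A y b -> (m + i)%:R * h <= T ->
  enorm (X (m + i) - y) ^+ 2 <= enorm (X i - y) ^+ 2 +
  2 * (m%:R * h) * (edot (W i - b) (X i - y) +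
    (L * C * (C * T + enorm (X 0%N - y)) + (L * C * T + enorm (W 0%N - b)) * C)
    * (m%:R * h)).
Proof.
move=> Ab; elim: m => [_|m IH mT]; first by rewrite add0n mul0r mulr0 mul0r addr0.
have mT' : (m + i)%:R * h <= T.
  by apply: le_trans mT; rewrite ler_pM2r// ler_nat addSn.
have iT : i%:R * h <= T.
  by apply: le_trans mT'; rewrite ler_pM2r// ler_nat leq_addl.
have T0 : 0%:R * h <= T by apply: le_trans iT; rewrite ler_pM2r// ler_nat.
have Tge : 0 <= T by rewrite mul0r in T0.
have LC : 0 <= L * C by rewrite mulr_ge0.
have mono : edot (X (m + i).+1 - X (m + i)) (X (m + i).+1 - y) <=
    h * edot (W (m + i) - b) (X (m + i).+1 - y).
  have := mA (stepA (m + i)) Ab; rewrite addrAC (edotDl (W (m + i) - b)) edotNl edotZl subr_ge0.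
  by rewrite ler_pdivrMl.
have sq : enorm (X (m + i).+1 - y) ^+ 2 <= enorm (X (m + i) - y) ^+ 2 +
    2 * edot (X (m + i).+1 - X (m + i)) (X (m + i).+1 - y).
  rewrite !enorm_sqr; set p := X (m + i).+1; have := edot_ge0 (p - X (m + i)).
  have -> : X (m + i) - y = (p - y) - (p - X (m + i)).
    by apply/rowP => k; rewrite !mxE; ring.
  move: (p - y) (p - X (m + i)) => u q; rewrite !edotE (edotC q u); lra.
have [_ dW] := euler_lipschitz mT' iT.
rewrite -mulrBl natrD addrK ger0_norm in dW; last by rewrite mulr_ge0// ltW.
have [dX _] := euler_lipschitz mT iT.
rewrite -mulrBl natrD addrK ger0_norm in dX; last by rewrite mulr_ge0// ltW.
have bX : enorm (X (m + i).+1 - y) <= C * T + enorm (X 0%N - y).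
  have [+ _] := euler_lipschitz mT T0; have := enorm_dist (X 0%N) (X (m.+1 + i)) y.
  rewrite mul0r subr0 ger0_norm; last by rewrite mulr_ge0// ltW.
  have : C * ((m.+1 + i)%:R * h) <= C * T by rewrite ler_wpM2l.
  rewrite addSn; lra.
have bW : enorm (W i - b) <= L * C * T + enorm (W 0%N - b).
  have [_] := euler_lipschitz iT T0; have := enorm_dist (W 0%N) (W i) b.
  rewrite mul0r subr0 ger0_norm; last by rewrite mulr_ge0// ltW.
  have : L * C * (i%:R * h) <= L * C * T by rewrite ler_wpM2l.
  lra.
have split_dot : edot (W (m + i) - b) (X (m + i).+1 - y) <=
    edot (W i - b) (X i - y) + enorm (W (m + i) - W i) * enorm (X (m + i).+1 - y) +
    enorm (W i - b) * enorm (X (m + i).+1 - X i).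
  have := cauchy_schwarz (W (m + i) - W i) (X (m + i).+1 - y).
  have := cauchy_schwarz (W i - b) (X (m + i).+1 - X i).
  rewrite !edotE; lra.
have := IH mT'; move: mono sq split_dot dW dX bX bW.
set P := C * T + _; set Q := L * C * T + _.
rewrite addSn => mono sq split_dot dW dX bX bW {}IH.
have k1 : enorm (W (m + i) - W i) * enorm (X (m + i).+1 - y) <= L * C * (m%:R * h) * P.
  by apply: ler_pM => //; exact: enorm_ge0.
have k2 : enorm (W i - b) * enorm (X (m + i).+1 - X i) <= Q * (C * (m.+1%:R * h)).
  by apply: ler_pM => //; exact: enorm_ge0.
have k3 : h * edot (W (m + i) - b) (X (m + i).+1 - y) <=
    h * (edot (W i - b) (X i - y) + L * C * (m%:R * h) * P + Q * (C * (m.+1%:R * h))).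
  by rewrite ler_pM2l//; lra.
have P0 : 0 <= P by rewrite addr_ge0 ?enorm_ge0// mulr_ge0.
have Q0 : 0 <= Q by rewrite addr_ge0 ?enorm_ge0// mulr_ge0.
have k4 : 0 <= L * C * P * h * h by rewrite !mulr_ge0// ltW.
have k5 : 0 <= Q * C * h * h by rewrite !mulr_ge0// ltW.
have m0 : 0 <= m%:R :> R by [].
have k6 : 0 <= L * C * P * h * h * m%:R by rewrite mulr_ge0.
have k7 : 0 <= Q * C * h * h * m%:R by rewrite mulr_ge0.
move: k3 k4 k5 k6 k7 IH mono sq; rewrite -[m.+1]addn1 natrD.
by move: (m%:R : R) => r; lra.
Qed.

End Estimates.
End ImplicitEuler.

(** * Passage to the limit along an ultrafilter *)

Section LimitTrajectory.
Context {R : realType} {n : nat}.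
Local Notation V := 'rV[R]_n.
Implicit Types (v a b : V) (A F : V -> set V).

(** The inclusion of the velocity of [x] in [w t - A (x t)], written without
    derivatives: these are the four discrete estimates in the limit of vanishing
    steps. The last one yields the inclusion, the second and third bound the
    velocity. *)
Record driven_trajectory A F (x w : R -> V) : Prop := DrivenTrajectory {
  driven_mem : forall t, 0 <= t -> F (x t) (w t);
  driven_bound : forall T, 0 <= T -> exists2 C : R, 0 <= C &
    [/\ forall s t, 0 <= s -> s <= t -> t <= T ->
          enorm (x t - x s) <= C * (t - s) /\ enorm (w t - w s) <= C * (t - s),
        forall y b s t, A y b -> 0 <= s -> s <= t -> t <= T ->
          enorm (x t - y) <=
          enorm (x s - y) + (t - s) * (enorm (w s - b) + C * (t - s)),
        forall s t d, 0 <= s -> s <= t -> 0 <= d -> t + d <= T ->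
          enorm (x (t + d) - x t) <= enorm (x (s + d) - x s) + (t - s) * (C * d)
      & forall y b, A y b -> exists B, forall s t, 0 <= s -> s <= t -> t <= T ->
          enorm (x t - y) ^+ 2 <= enorm (x s - y) ^+ 2 +
          2 * (t - s) * (edot (w s - b) (x s - y) + B * (t - s))] }.

Definition grid_index (N : nat) (t : R) : nat := Num.truncn (t * N.+1%:R).
Definition grid_time (N : nat) (t : R) : R := (grid_index N t)%:R * N.+1%:R^-1.

Lemma grid_time_itv N t : 0 <= t -> t - N.+1%:R^-1 <= grid_time N t <= t.
Proof.
move=> t0; have N0 : 0 < N.+1%:R :> R by [].
have /truncn_itv/andP[le lt] : 0 <= t * N.+1%:R by rewrite mulr_ge0.
rewrite /grid_time ler_pdivrMr// le andbT lerBlDr -[X in _ + X]mul1r -mulrDl.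
by rewrite ler_pdivlMr// natr1 ltW.
Qed.

Lemma grid_time_cvg (U : set_system nat) (UU : ProperFilter U) t :
  \oo `<=` U -> 0 <= t -> grid_time N t @[N --> U] --> t.
Proof.
move=> sU t0; apply: (@squeeze_cvgr _ _ _ _ (fun N => t - N.+1%:R^-1) (fun=> t)).
- by apply: nearW => N; exact: grid_time_itv.
- rewrite -[t in _ --> t]subr0; apply: cvgB; first exact: cvg_cst.
  by apply: cvg_trans (@cvg_harmonic R); exact: (cvg_app _ sU).
- exact: cvg_cst.
Qed.

(** Each [W i] is close to a point of the closed set [F x]. *)
Lemma closed_lipschitz_graph F (L : R) I (U : set_system I) (UU : ProperFilter U)
    (X W : I -> V) x w : lipschitz_cusco L F -> (forall i, F (X i) (W i)) ->
  X @ U --> x -> W @ U --> w -> F x w.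
Proof.
move=> hF FXW Xx Ww; have [/(_ x)[_ _ cF] _] := hF.
have clF : closed (F x) by apply: compact_closed => //; exact: norm_hausdorff.
have /choice[z zP] i : exists z, F x z /\ enorm (z - W i) <= `|L| * enorm (x - X i).
  by have [z] := lipschitz_cusco_near x hF (FXW i); exists z.
apply: (closed_cvg _ clF (F := U) (u_ := z)); first by apply: nearW => i; have [] := zP i.
apply: cvg_enorm => e e0.
have c : `|L| * enorm (x - X i) + enorm (W i - w) @[i --> U] -->
    `|L| * enorm (x - x) + enorm (w - w).
  apply: cvgD.
    apply: cvgM; first exact: cvg_cst.
    by apply: enorm_cvg; apply: cvgB => //; exact: cvg_cst.
  by apply: enorm_cvg; apply: cvgB => //; exact: cvg_cst.
move: c; rewrite !subrr enorm0 mulr0 addr0 => /cvgrPdist_le/(_ e e0).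
apply: filterS => i; rewrite sub0r normrN => h.
have [_ zW] := zP i; rewrite enormBC; have := enorm_dist (W i) (z i) w.
by move: h; have := ler_norm (`|L| * enorm (x - X i) + enorm (W i - w)); lra.
Qed.

(** The step functions of the schemes with mesh [1 / (N + 1)] have a limit at each
    time along any ultrafilter finer than the cofinite one. *)
Lemma driven_trajectory_exists A F (L : R) x0 v a : maximal_monotone A ->
  lipschitz_cusco L F -> A x0 a -> F x0 v ->
  exists x w, [/\ x 0 = x0, w 0 = v & driven_trajectory A F x w].
Proof.
move=> hA hF Aa Fv; have [mA _] := hA.
pose h (N : nat) : R := N.+1%:R^-1.
have h0 N : 0 < h N by rewrite invr_gt0.
have /choice[X /choice[W XW]] (N : nat) := euler_scheme_exists hA hF (h0 N) Fv.
have L0 : 0 <= `|L| by [].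
have sch N : euler_scheme A F `|L| (h N) (X N) (W N) by case: (XW N).
have X0 N : X N 0%N = x0 by case: (XW N).
have W0 N : W N 0%N = v by case: (XW N).
pose C (T : R) : R := expR (`|L| * T) * enorm (v - a).
have C0 (T : R) : 0 <= C T by rewrite mulr_ge0 ?expR_ge0 ?enorm_ge0.
have speed N T k : k%:R * h N <= T -> enorm (X N k.+1 - X N k) <= C T * h N.
  move=> kT; have := @euler_speed _ _ _ _ _ _ _ _ mA L0 (h0 N) (sch N) a k.
  rewrite X0 W0 => /(_ Aa) H; apply: le_trans H _.
  by rewrite ler_pM2r// ler_wpM2r ?enorm_ge0// ler_expR ler_wpM2l.
have lip N (T : R) i j : i%:R * h N <= T -> j%:R * h N <= T ->
    enorm (X N i - X N j) <= C T * `|i%:R * h N - j%:R * h N| /\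
    enorm (W N i - W N j) <= `|L| * C T * `|i%:R * h N - j%:R * h N|.
  exact: (euler_lipschitz L0 (h0 N) (sch N) (speed N T)).
have gT N (t T : R) : 0 <= t -> t <= T -> (grid_index N t)%:R * h N <= T.
  by move=> t0; apply: le_trans; have /andP[] := grid_time_itv N t0.
have [U [UU sU]] := ultraFilterLemma eventually_filter.
have /choice[x xP] t : exists l : V, 0 <= t -> X N (grid_index N t) @[N --> U] --> l.
  have [t0|] := leP 0 t; last by exists 0.
  have [|l ?] := @ultra_bounded_cvg _ _ _ U (fun N => X N (grid_index N t)) (C t * t + enorm x0).
    apply: nearW => N; have t00 : 0%:R * h N <= t by rewrite mul0r.
    have [+ _] := lip N t _ _ (gT N t t t0 (lexx _)) t00.
    rewrite X0 mul0r subr0 (ger0_norm (mulr_ge0 (ler0n _ _) (ltW (h0 N)))).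
    have := ler_wpM2l (C0 t) (gT N t t t0 (lexx _)).
    have := enormD (X N (grid_index N t) - x0) x0; rewrite subrK.
    by move: (C t * (_ * _)) (C t * t) => r1 r2; lra.
  by exists l.
have /choice[w wP] t : exists l : V, 0 <= t -> W N (grid_index N t) @[N --> U] --> l.
  have [t0|] := leP 0 t; last by exists 0.
  have [|l ?] := @ultra_bounded_cvg _ _ _ U (fun N => W N (grid_index N t)) (`|L| * C t * t + enorm v).
    apply: nearW => N; have t00 : 0%:R * h N <= t by rewrite mul0r.
    have [_] := lip N t _ _ (gT N t t t0 (lexx _)) t00.
    rewrite W0 mul0r subr0 (ger0_norm (mulr_ge0 (ler0n _ _) (ltW (h0 N)))).
    have := ler_wpM2l (mulr_ge0 L0 (C0 t)) (gT N t t t0 (lexx _)).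
    have := enormD (W N (grid_index N t) - v) v; rewrite subrK.
    by move: (`|L| * C t * (_ * _)) (`|L| * C t * t) => r1 r2; lra.
  by exists l.
have g0 N : grid_index N 0 = 0%N by rewrite /grid_index mul0r truncn0.
have cgrid t : 0 <= t -> grid_time N t @[N --> U] --> t by exact: grid_time_cvg sU.
exists x, w; split.
- have c : X N (grid_index N 0) @[N --> U] --> x0.
    by under eq_fun do rewrite g0 X0; exact: cvg_cst.
  exact: norm_cvg_unique (xP 0 (lexx 0)) c.
- have c : W N (grid_index N 0) @[N --> U] --> v.
    by under eq_fun do rewrite g0 W0; exact: cvg_cst.
  exact: norm_cvg_unique (wP 0 (lexx 0)) c.
split=> [t t0|T T0].
  apply: (closed_lipschitz_graph _ hF _ (xP t t0) (wP t t0)) => N.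
  by case: (sch N).
(* the horizon [T + 1] leaves room for shifted indices, which overshoot by one mesh *)
pose c := C (T + 1); pose K := `|L| * c.
have c0 : 0 <= c by exact: C0.
have K0 : 0 <= K by rewrite mulr_ge0.
have TT1 (t : R) : t <= T -> t <= T + 1 by lra.
have idx_le N s t : s <= t -> (grid_index N s <= grid_index N t)%N.
  by move=> st; apply: le_truncn; rewrite ler_pM2r.
have idxB N s t : s <= t ->
    (grid_index N t - grid_index N s)%:R * h N = grid_time N t - grid_time N s.
  by move=> st; rewrite natrB ?idx_le// mulrBl.
have cgB s t : 0 <= s -> 0 <= t ->
    grid_time N t - grid_time N s @[N --> U] --> t - s.
  by move=> s0 t0; apply: cvgB; exact: cgrid.
have cxy y s : 0 <= s -> enorm (X N (grid_index N s) - y) @[N --> U] --> enorm (x s - y).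
  by move=> s0; apply: enorm_cvg; apply: cvgB; [exact: xP|exact: cvg_cst].
exists (c + K); first exact: addr_ge0.
split.
- move=> s t s0 st tT.
  have t0 := le_trans s0 st.
  have cn : `|grid_time N t - grid_time N s| @[N --> U] --> `|t - s|.
    by apply: cvg_norm; exact: cgB.
  have H N := lip N _ _ _ (gT N t _ t0 (TT1 _ tT)) (gT N s _ s0 (TT1 _ (le_trans st tT))).
  have tE : `|t - s| = t - s by rewrite ger0_norm// subr_ge0.
  have ts0 : 0 <= t - s by rewrite subr_ge0.
  split.
    apply: (@le_trans _ _ (c * `|t - s|)); last by rewrite tE ler_wpM2r// lerDl.
    have e1 : enorm (X N (grid_index N t) - X N (grid_index N s)) @[N --> U] --> enorm (x t - x s).
      by apply: enorm_cvg; apply: cvgB; exact: xP.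
    have e2 : c * `|grid_time N t - grid_time N s| @[N --> U] --> c * `|t - s|.
      by apply: cvgM => //; exact: cvg_cst.
    by apply: ler_cvg_to e1 e2 _; apply: nearW => N; have [] := H N.
  apply: (@le_trans _ _ (K * `|t - s|)); last by rewrite tE ler_wpM2r// lerDr.
  have e1 : enorm (W N (grid_index N t) - W N (grid_index N s)) @[N --> U] --> enorm (w t - w s).
    by apply: enorm_cvg; apply: cvgB; exact: wP.
  have e2 : K * `|grid_time N t - grid_time N s| @[N --> U] --> K * `|t - s|.
    by apply: cvgM => //; exact: cvg_cst.
  by apply: ler_cvg_to e1 e2 _; apply: nearW => N; have [] := H N.
- move=> y b s t Ab s0 st tT; have t0 := le_trans s0 st.
  have e2 : enorm (X N (grid_index N s) - y) + (grid_time N t - grid_time N s) *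
      (enorm (W N (grid_index N s) - b) + K * (grid_time N t - grid_time N s)) @[N --> U]
      --> enorm (x s - y) + (t - s) * (enorm (w s - b) + K * (t - s)).
    apply: cvgD; first exact: cxy.
    apply: cvgM; first exact: cgB.
    apply: cvgD; last by apply: cvgM; [exact: cvg_cst|exact: cgB].
    by apply: enorm_cvg; apply: cvgB; [exact: wP|exact: cvg_cst].
  apply: (@le_trans _ _ (enorm (x s - y) + (t - s) * (enorm (w s - b) + K * (t - s)))).
    apply: ler_cvg_to (cxy y t t0) e2 _; apply: nearW => N.
    have := @euler_fixed_point _ _ _ _ _ _ _ _ _ _ mA L0 (h0 N) c0 (sch N) (speed N (T + 1))
      (grid_index N s) (grid_index N t - grid_index N s) y b Ab.
    by rewrite subnK ?idx_le// idxB// => -> //; exact: (gT N t _ t0 (TT1 _ tT)).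
  rewrite lerD2l ler_wpM2l ?subr_ge0// lerD2l ler_wpM2r ?subr_ge0//.
  by rewrite lerDr.
- move=> s t d s0 st d0 tdT; have t0 := le_trans s0 st.
  have sd0 : 0 <= s + d by rewrite addr_ge0.
  have td0 : 0 <= t + d by rewrite addr_ge0.
  have tT : t <= T by lra.
  have e1 : enorm (X N (grid_index N (t + d)) - X N (grid_index N t)) @[N --> U] -->
      enorm (x (t + d) - x t).
    by apply: enorm_cvg; apply: cvgB; exact: xP.
  have e2 : c * `|grid_time N (t + d) - (grid_time N (s + d) + (grid_time N t - grid_time N s))| +
     (enorm (X N (grid_index N (s + d)) - X N (grid_index N s)) +
     (grid_time N t - grid_time N s) * (K * (grid_time N (s + d) - grid_time N s))) @[N --> U] -->
     c * `|t + d - (s + d + (t - s))| + (enorm (x (s + d) - x s) + (t - s) * (K * (s + d - s))).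
    apply: cvgD.
      apply: cvgM; first exact: cvg_cst.
      apply: cvg_norm; apply: cvgB; first exact: cgrid.
      by apply: cvgD; [exact: cgrid|exact: cgB].
    apply: cvgD; first by apply: enorm_cvg; apply: cvgB; exact: xP.
    by apply: cvgM; [exact: cgB|apply: cvgM; [exact: cvg_cst|exact: cgB]].
  have {e2}le : enorm (x (t + d) - x t) <=
      c * `|t + d - (s + d + (t - s))| + (enorm (x (s + d) - x s) + (t - s) * (K * (s + d - s))).
    apply: ler_cvg_to e1 e2 _; apply: nearW => N.
    set j := grid_index N s; set p := (grid_index N (s + d) - j)%N.
    set m := (grid_index N t - j)%N.
    have ssd : s <= s + d by rewrite lerDl.
    have pj : (p + j)%N = grid_index N (s + d) by rewrite subnK// idx_le.
    have mj : (m + j)%N = grid_index N t by rewrite subnK// idx_le.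
    have mpj : (m + (p + j))%:R * h N = grid_time N (s + d) + (grid_time N t - grid_time N s).
      by rewrite pj natrD mulrDl idxB// addrC.
    have mT : (m + (p + j))%:R * h N <= T + 1.
      rewrite mpj; have /andP[_ ?] := grid_time_itv N sd0.
      have /andP[_ ?] := grid_time_itv N t0; have /andP[+ _] := grid_time_itv N s0.
      have : h N <= 1 by rewrite invf_le1 ?ler1n.
      by rewrite -/(h N); lra.
    have := @euler_shift _ _ _ _ _ _ _ _ _ _ mA L0 (h0 N) (sch N) (speed N (T + 1)) j p m mT.
    (* the shifted index and the index of [t + d] differ by rounding only *)
    rewrite mj pj idxB// idxB// => sh.
    have [+ _] := lip N _ _ _ (gT N (t + d) _ td0 (TT1 _ tdT)) mT.
    rewrite mpj pj => l1; apply: le_trans (enorm_dist (X N (m + (p + j))%N) _ _) _.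
    by rewrite pj; apply: lerD.
  apply: le_trans le _.
  have -> : t + d - (s + d + (t - s)) = 0 by ring.
  rewrite normr0 mulr0 add0r lerD2l ler_wpM2l ?subr_ge0// addrAC subrr add0r.
  by rewrite ler_wpM2r// lerDr.
- move=> y b Ab.
  exists (K * (c * (T + 1) + enorm (x0 - y)) + (K * (T + 1) + enorm (v - b)) * c).
  set B := _ + _ * c; move=> s t s0 st tT; have t0 := le_trans s0 st.
  have csq r : 0 <= r -> enorm (X N (grid_index N r) - y) ^+ 2 @[N --> U] --> enorm (x r - y) ^+ 2.
    by move=> r0; rewrite expr2; under eq_fun do rewrite expr2; apply: cvgM; exact: cxy.
  have e2 : enorm (X N (grid_index N s) - y) ^+ 2 + 2 * (grid_time N t - grid_time N s) *
      (edot (W N (grid_index N s) - b) (X N (grid_index N s) - y) +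
       B * (grid_time N t - grid_time N s)) @[N --> U] -->
      enorm (x s - y) ^+ 2 + 2 * (t - s) * (edot (w s - b) (x s - y) + B * (t - s)).
    apply: cvgD; first exact: csq.
    apply: cvgM; first by apply: cvgM; [exact: cvg_cst|exact: cgB].
    apply: cvgD; last by apply: cvgM; [exact: cvg_cst|exact: cgB].
    by apply: edot_cvg; apply: cvgB; [exact: wP|exact: cvg_cst|exact: xP|exact: cvg_cst].
  apply: ler_cvg_to (csq t t0) e2 _; apply: nearW => N.
  have := @euler_energy _ _ _ _ _ _ _ _ _ _ mA L0 (h0 N) c0 (sch N) (speed N (T + 1))
    (grid_index N s) (grid_index N t - grid_index N s) y b Ab.
  rewrite subnK ?idx_le// idxB// X0 W0; apply; exact: (gT N t _ t0 (TT1 _ tT)).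
Qed.

End LimitTrajectory.

(** * Velocities of driven trajectories *)

Section Velocity.
Context {R : realType} {n : nat}.
Local Notation V := 'rV[R]_n.
Implicit Types (v a b y : V) (A F : V -> set V).

(** If [Q] missed a neighbourhood of [p] along [G], some ultrafilter finer than [G]
    would avoid it too. *)
Lemma ultra_cvg {I} {T : topologicalType} (G : set_system I) (Q : I -> T) (p : T) :
  ProperFilter G -> (forall U, UltraFilter U -> G `<=` U -> Q @ U --> p) ->
  Q @ G --> p.
Proof.
move=> PG H B nB; apply: contrapT => nGB.
pose G' := within (~` (Q @^-1` B)) G.
have PG' : ProperFilter G'.
  split; last exact: within_filter.
  rewrite /G' /within /= => h; apply: nGB; apply: filterS h => i.
  by rewrite -[X in _ -> X]notK.
have [U [UU sU]] := ultraFilterLemma PG'.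
have sGU : G `<=` U by move=> D GD; apply: sU; rewrite /G' /within; apply: filterS GD.
have UB : U (Q @^-1` B) by exact: H.
have UnB : U (~` (Q @^-1` B)) by apply: sU; rewrite /G' /within; exact: nearW.
by have [i []] := filter_ex (filterI UB UnB).
Qed.

(** A limit [q] of difference quotients makes [w - q] monotonically related to the
    graph of [A], and maximality applies. *)
Lemma velocity_mem A {I : topologicalType} (G : set_system I) (PG : ProperFilter G)
    (Q : I -> V) (x w q : V) :
  maximal_monotone A ->
  (forall y b, A y b -> forall e : R, 0 < e -> \forall i \near G,
     edot (Q i) (x - y) <= edot (w - b) (x - y) + e) ->
  Q @ G --> q -> A x (w - q).
Proof.
move=> hA HQ Qq; apply: maximal_mem => // y b Ab.
have le : edot q (x - y) <= edot (w - b) (x - y).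
  rewrite -subr_le0; apply: (@le0_of_le_small _ _ 1) => e e0 _; rewrite mulr1 lerBlDl.
  have c1 : edot (Q i) (x - y) @[i --> G] --> edot q (x - y).
    by apply: edot_cvg => //; exact: cvg_cst.
  have c2 : edot (w - b) (x - y) + e @[_ --> G] --> edot (w - b) (x - y) + e.
    exact: cvg_cst.
  by apply: ler_cvg_to c1 c2 _; exact: HQ.
by move: le; rewrite addrAC (edotDl (w - b)) edotNl subr_ge0.
Qed.

(** The selection principle for velocities: difference quotients accumulate only
    at [w - a] with [a \in A x], and their norms are asymptotically at most the
    least norm of such vectors; strict convexity leaves one accumulation point. *)
Lemma velocity_limit A {I : topologicalType} (G : set_system I) (PG : ProperFilter G)
    (Q : I -> V) (x w : V) :
  maximal_monotone A -> A x !=set0 ->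
  (forall y b, A y b -> forall e : R, 0 < e -> \forall i \near G,
     edot (Q i) (x - y) <= edot (w - b) (x - y) + e) ->
  (forall e : R, 0 < e -> \forall i \near G,
     enorm (Q i) <= enorm (w - proj_pt (A x) w) + e) ->
  Q @ G --> w - proj_pt (A x) w.
Proof.
move=> hA A0 HQ HN; apply: ultra_cvg => U UU sGU.
have [q Qq] := ultra_bounded_cvg UU (sGU _ (HN 1 ltr01)).
have Aq : A x (w - q).
  by apply: velocity_mem hA _ Qq => y b Ab e e0; apply: sGU; exact: HQ.
have qle : enorm q <= enorm (w - proj_pt (A x) w).
  rewrite -subr_le0; apply: (@le0_of_le_small _ _ 1) => e e0 _; rewrite mulr1 lerBlDl.
  have c2 : enorm (w - proj_pt (A x) w) + e @[_ --> U] --> enorm (w - proj_pt (A x) w) + e.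
    exact: cvg_cst.
  by apply: ler_cvg_to (enorm_cvg Qq) c2 _; apply: sGU; exact: HN.
rewrite -(proj_pt_unique (@maximal_closed_value _ _ A x hA) (maximal_convex_value hA) Aq).
  by rewrite opprB addrC subrK.
by rewrite opprB addrC subrK.
Qed.

Section Driven.
Context {A F : V -> set V} {x w : R -> V}.
Context (hA : maximal_monotone A) (dr : driven_trajectory A F x w).

Definition quotient t s : V := s^-1 *: (x (s + t) - x t).
Definition velocity t : V := w t - proj_pt (A (x t)) (w t).

Lemma quotient_bound t : 0 <= t -> exists2 C, 0 <= C &
  forall s, s != 0 -> s <= 1 -> 0 <= s + t -> enorm (quotient t s) <= C.
Proof.
move=> t0; have [|C C0 [lip _ _ _]] := driven_bound dr (T := t + 1); first lra.
exists C => // s s0 s1 st0.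
rewrite /quotient enormZ normfV ler_pdivrMl ?normr_gt0// mulrC.
have [sp|sn] := leP 0 s.
  rewrite ger0_norm//; have [+ _] := lip t (s + t) ltac:(lra) ltac:(lra) ltac:(lra).
  by rewrite addrK.
rewrite ltr0_norm// enormBC; have [+ _] := lip (s + t) t ltac:(lra) ltac:(lra) ltac:(lra).
by rewrite opprD addrCA subrr addr0.
Qed.

(** The energy inequality read as a bound on difference quotients. For [s < 0] it
    starts from [s + t], and the Lipschitz bounds bring it back to [t]. *)
Lemma quotient_slope t y b : 0 <= t -> A y b -> exists2 M, 0 <= M &
  forall s, s != 0 -> `|s| <= 1 -> 0 <= s + t ->
    edot (quotient t s) (x t - y) <= edot (w t - b) (x t - y) + M * `|s|.
Proof.
move=> t0 Ab; have [|C C0 [lip _ _ en]] := driven_bound dr (T := t + 1); first lra.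
have [B HB] := en _ _ Ab.
exists (`|B| + C * (enorm (x t - y) + C) + enorm (w t - b) * C + C ^+ 2).
  by rewrite !addr_ge0 ?mulr_ge0 ?addr_ge0 ?enorm_ge0 ?exprn_ge0.
move=> s s0 s1 st0; have BB : 0 <= `|B| - B by rewrite subr_ge0 ler_norm.
have sq : enorm (x (s + t) - y) ^+ 2 = enorm (x t - y) ^+ 2 +
    2 * edot (x (s + t) - x t) (x t - y) + enorm (x (s + t) - x t) ^+ 2.
  rewrite !enorm_sqr; have -> : x (s + t) - y = (x (s + t) - x t) + (x t - y).
    by rewrite subrKA.
  move: (x (s + t) - x t) (x t - y) => p q; rewrite !edotE (edotC q p); ring.
have d2 := sqr_ge0 (enorm (x (s + t) - x t)).
rewrite /quotient edotZl.
set G := edot (w t - b) (x t - y).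
have N1 := enorm_ge0 (x t - y); have N2 := enorm_ge0 (w t - b).
have [sp|sn] := leP 0 s.
  have spp : 0 < s by rewrite lt_def s0.
  rewrite ger0_norm// in s1 *.
  have := HB t (s + t) ltac:(lra) ltac:(lra) ltac:(lra).
  rewrite addrK sq -/G ler_pdivrMl// => h.
  have k : 0 <= (C * (enorm (x t - y) + C) + enorm (w t - b) * C + C ^+ 2 + (`|B| - B)) * s * s.
    apply: mulr_ge0 => //; apply: mulr_ge0 => //.
    by repeat (apply: addr_ge0 => //); rewrite ?mulr_ge0 ?addr_ge0 ?exprn_ge0.
  by lra.
rewrite ltr0_norm// in s1 *.
have [lx lw] := lip (s + t) t ltac:(lra) ltac:(lra) ltac:(lra).
have := HB (s + t) t ltac:(lra) ltac:(lra) ltac:(lra).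
have E : t - (s + t) = - s by ring.
rewrite E in lx lw *; rewrite sq.
set D := edot (x (s + t) - x t) (x t - y) in sq *.
rewrite -[s]opprK invrN mulNr -mulrN ler_pdivrMl ?oppr_gt0// opprK => h.
have split_dot : edot (w (s + t) - b) (x (s + t) - y) <= G +
   enorm (w t - w (s + t)) * enorm (x (s + t) - y) + enorm (w t - b) * enorm (x t - x (s + t)).
  have := cauchy_schwarzN (w t - w (s + t)) (x (s + t) - y).
  have := cauchy_schwarzN (w t - b) (x t - x (s + t)).
  rewrite /G !edotE; lra.
have k0 : enorm (x (s + t) - y) <= enorm (x t - y) + C.
  have := enorm_dist (x t) (x (s + t)) y; rewrite (enormBC _ (x t)) => ?.
  by have : C * - s <= C * 1; [rewrite ler_wpM2l|lra].
have k1 : enorm (w t - w (s + t)) * enorm (x (s + t) - y) <= C * - s * (enorm (x t - y) + C).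
  by apply: ler_pM => //; exact: enorm_ge0.
have k2 : enorm (w t - b) * enorm (x t - x (s + t)) <= enorm (w t - b) * (C * - s).
  by rewrite ler_wpM2l.
have k3 : enorm (x (s + t) - x t) ^+ 2 <= (C * - s) ^+ 2.
  by rewrite lerXn2r ?nnegrE ?enorm_ge0// ?(enormBC (x (s + t)))// (le_trans _ lx) ?enorm_ge0.
have k4 : - s * edot (w (s + t) - b) (x (s + t) - y) <= - s * (G +
    C * - s * (enorm (x t - y) + C) + enorm (w t - b) * (C * - s)).
  by rewrite ler_pM2l ?oppr_gt0//; lra.
have k5 : 0 <= (`|B| - B) * - s * - s by rewrite !mulr_ge0 ?oppr_ge0// ltW.
have k6 : 0 <= C ^+ 2 * - s * - s by rewrite !mulr_ge0 ?exprn_ge0 ?oppr_ge0// ltW.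
by move: h k3 k4 k5 k6; rewrite expr2; lra.
Qed.

Lemma quotient_slope_near (G : set_system R) (FG : Filter G) t y b (e : R) : 0 <= t -> A y b ->
  0 < e -> (forall d : R, 0 < d -> \forall s \near G, [/\ s != 0, `|s| <= d & 0 <= s + t]) ->
  \forall s \near G, edot (quotient t s) (x t - y) <= edot (w t - b) (x t - y) + e.
Proof.
move=> t0 Ab e0 HG; have [M M0 HM] := quotient_slope t0 Ab.
have M1 : 0 < M + 1 by lra.
have := HG (Num.min 1 (e / (M + 1))); rewrite lt_min ltr01 divr_gt0// => /(_ isT).
apply: filterS => s [s0 + st]; rewrite le_min => /andP[s1]; rewrite ler_pdivlMr// => s2.
apply: le_trans (HM s s0 s1 st) _; rewrite lerD2l; have := normr_ge0 s.
by move: s2; rewrite mulrC mulrDl; lra.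
Qed.

Lemma near_right (t d : R) : 0 <= t -> 0 < d ->
  \forall s \near 0^'+, [/\ s != 0, `|s| <= d & 0 <= s + t].
Proof.
move=> t0 d0; near=> s.
have s0 : 0 < s by near: s; exact: nbhs_right_gt.
split; [by rewrite gt_eqF| |by rewrite addr_ge0// ltW].
by rewrite gtr0_norm//; near: s; exact: nbhs_right_le.
Unshelve. all: by end_near. Qed.

Lemma driven_dom t : 0 <= t -> A (x t) !=set0.
Proof.
move=> t0; have [U [UU sU]] := ultraFilterLemma (at_right_proper_filter (0 : R)).
have [C C0 HC] := quotient_bound t0.
have [|q Qq] := @ultra_bounded_cvg _ _ _ _ (quotient t) C UU.
  apply: sU; apply: filterS (near_right t0 ltr01) => s [s0 s1 st].
  by apply: HC => //; apply: le_trans (ler_norm _) s1.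
exists (w t - q); apply: velocity_mem hA _ Qq => y b Ab e e0; apply: sU.
exact: (quotient_slope_near _ t0 Ab e0 (fun d => @near_right t d t0)).
Qed.

(** Compare the trajectory with the rest point [x t] under the forcing
    [proj_pt (A (x t)) (w t)]: the right quotients have asymptotically the least
    norm. *)
Lemma right_velocity t : 0 <= t -> quotient t @ 0^'+ --> velocity t.
Proof.
move=> t0; apply: velocity_limit => //; first exact: driven_dom.
  by move=> y b Ab e e0; apply: quotient_slope_near => // d; exact: near_right.
move=> e e0; have [|C C0 [_ fp _ _]] := driven_bound dr (T := t + 1); first lra.
have C1 : 0 < C + 1 by lra.
have [Ap _] := proj_ptP (w t) (@maximal_closed_value _ _ A (x t) hA) (driven_dom t0).
near=> s.
have s0 : 0 < s by near: s; exact: nbhs_right_gt.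
have s1 : s <= 1 by near: s; exact: nbhs_right_le.
have se : s <= e / (C + 1) by near: s; apply: nbhs_right_le; exact: divr_gt0.
rewrite /quotient enormZ gtr0_norm ?invr_gt0// ler_pdivrMl//.
have := fp _ _ t (s + t) Ap ltac:(lra) ltac:(lra) ltac:(lra).
rewrite subrr enorm0 add0r addrK => h; apply: le_trans h _.
rewrite ler_pM2l// lerD2l; move: se; rewrite ler_pdivlMr// mulrDr mulr1 mulrC; lra.
Unshelve. all: by end_near. Qed.

(** The trajectory and its shift by [d] drift apart by at most [C * d] per unit of
    time; divide by [d] and let it tend to 0. *)
Lemma velocity_almost_decreasing T : 0 <= T -> exists2 C, 0 <= C &
  forall s t, 0 <= s -> s <= t -> t <= T ->
  [/\ enorm (velocity t) - C * t <= enorm (velocity s) - C * s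
    & enorm (x t - x s) <= (t - s) * (enorm (velocity s) + C * (t - s))].
Proof.
move=> T0; have [|C C0 [_ fp sh _]] := driven_bound dr (T := T + 1); first lra.
exists C => // s t s0 st tT; have t0 := le_trans s0 st; split; last first.
  have [Ap _] := proj_ptP (w s) (@maximal_closed_value _ _ A (x s) hA) (driven_dom s0).
  by have := fp _ _ s t Ap s0 st; rewrite subrr enorm0 add0r; apply; lra.
have c1 : enorm (quotient t d) @[d --> 0^'+] --> enorm (velocity t).
  by apply: enorm_cvg; exact: right_velocity.
have c2 : enorm (quotient s d) + (t - s) * C @[d --> 0^'+] --> enorm (velocity s) + (t - s) * C.
  by apply: cvgD; [exact: enorm_cvg (right_velocity s0)|exact: cvg_cst].
rewrite lerBlDr -addrA -mulrN -mulrDr [- s + t]addrC [C * _]mulrC.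
apply: ler_cvg_to c1 c2 _; near=> d.
have d0 : 0 < d by near: d; exact: nbhs_right_gt.
have d1 : d <= 1 by near: d; exact: nbhs_right_le.
rewrite /quotient !enormZ gtr0_norm ?invr_gt0// ler_pdivrMl// mulrDr mulVKf ?gt_eqF//.
have := sh s t d s0 st (ltW d0); rewrite !(addrC d) => /(_ ltac:(lra)).
by move: (enorm (_ - _)) (enorm (_ - _)) => p q; lra.
Unshelve. all: by end_near. Qed.

(** The left quotients at [t] are bounded by the speed slightly before [t]. If the
    almost decreasing speed does not jump down at [t], this is asymptotically the
    least norm, and [velocity_limit] applies on the left too. *)
Lemma two_sided_velocity (v : R -> R) T C t :
  (forall s, 0 <= s -> enorm (velocity s) = v s) -> 0 < t -> t <= T -> 0 <= C ->
  (forall s t, 0 <= s -> s <= t -> t <= T ->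
   [/\ v t - C * t <= v s - C * s
    & enorm (x t - x s) <= (t - s) * (v s + C * (t - s))]) ->
  (forall e : R, 0 < e -> exists s, [/\ 0 <= s, s < t &
     v s - C * s < v t - C * t + e]) ->
  quotient t @ 0^' --> velocity t.
Proof.
move=> vE t0 tT C0 HC good; have t0' := ltW t0.
suff lv : quotient t @ 0^'- --> velocity t.
  move=> B nB; have := right_velocity t0' nB; have := lv B nB.
  rewrite /= /nbhs /= /at_left /at_right /within /dnbhs /=.
  apply: filterS2 => s sl sr s0.
  by have := s0; rewrite neq_lt => /orP[/sl|/sr].
have near_left d : 0 < d -> \forall s \near 0^'-, [/\ s != 0, `|s| <= d & 0 <= s + t].
  move=> d0; near=> s.
  have s0 : s < 0 by near: s; exact: nbhs_left_lt.
  split; first by rewrite lt_eqF.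
    by rewrite ltr0_norm// lerNl; near: s; apply: nbhs_left_ge; rewrite oppr_lt0.
  by rewrite -[t]opprK subr_ge0; near: s; apply: nbhs_left_ge; rewrite oppr_lt0.
apply: velocity_limit => //; first exact: driven_dom.
  by move=> y b Ab e e0; apply: quotient_slope_near.
move=> e e0; have e2 : 0 < e / 2 by rewrite divr_gt0.
have [s1 [s10 s1t gs1]] := good _ e2.
have C1 : 0 < C + 1 by lra.
near=> s.
have s0 : s < 0 by near: s; exact: nbhs_left_lt.
have st : s1 - t <= s by near: s; apply: nbhs_left_ge; rewrite subr_lt0.
have se : - s <= e / 2 / (C + 1).
  by rewrite lerNl; near: s; apply: nbhs_left_ge; rewrite oppr_lt0 divr_gt0.
have s1s : s1 <= s + t by lra.
have stt : s + t <= t by lra.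
have st0 : 0 <= s + t by lra.
have [d1 _] := HC _ _ s10 s1s (le_trans stt tT).
have [_ d2] := HC _ _ st0 stt tT.
rewrite -/(velocity t) vE//.
rewrite /quotient enormZ enormBC normfV ltr0_norm// ler_pdivrMl ?oppr_gt0//.
apply: le_trans d2 _; have -> : t - (s + t) = - s by ring.
rewrite ler_pM2l ?oppr_gt0//.
have k : 0 <= C * - s by rewrite mulr_ge0// oppr_ge0 ltW.
move: se; rewrite ler_pdivlMr// mulrDr mulr1 => se.
by lra.
Unshelve. all: by end_near. Qed.

End Driven.
End Velocity.

(** * Existence of solutions with prescribed initial velocity *)

Section Solution.
Context {R : realType}.

(** The ranges jumped over at such points are disjoint intervals, and each contains
    a rational. *)
Lemma countable_left_jumps (g : R -> R) (T : R) :
  (forall s t, 0 <= s -> s <= t -> t <= T -> g t <= g s) ->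
  countable [set t | 0 < t /\ t <= T /\ exists2 e : R, 0 < e &
    forall s, 0 <= s -> s < t -> g t + e <= g s].
Proof.
move=> mono; set D := mkset _.
have /choice[r rP] (t : R) : exists q : rat, D t ->
    g t < ratr q /\ forall s, 0 <= s -> s < t -> ratr q < g s.
  have [[t0 [tT [e e0 He]]]|nD] := pselect (D t); last by exists 0 => /nD.
  have [|q] := @rat_in_itvoo R (g t) (g t + e); first by rewrite ltrDl.
  rewrite in_itv/= => /andP[q1 q2]; exists q => _; split=> // s s0 st.
  exact: lt_le_trans q2 (He _ s0 st).
apply/countable_injP; exists (pickle \o r) => s t /set_mem Ds /set_mem Dt /=.
move=> /(pcan_inj pickleK) rst.
wlog lt : s t Ds Dt rst / s < t => [H|].
  have [//|st|//] := ltgtP s t; first exact: H.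
  by apply/esym; apply: H.
have [_ /(_ s (ltW (proj1 Ds)) lt)] := rP _ Dt; rewrite -rst.
by have [lt' _] := rP _ Ds => /(lt_trans lt'); rewrite ltxx.
Qed.

Context {n : nat}.
Local Notation V := 'rV[R]_n.
Implicit Types (A F : V -> set V) (S : set V).

(** The exceptional null set consists of 0 and of the downward jumps of the speed;
    the constant of [velocity_almost_decreasing] depends on the horizon, hence one
    countable set for each integer horizon. *)
Lemma driven_is_solution A F (x w : R -> V) : maximal_monotone A ->
  driven_trajectory A F x w -> is_solution F A (x 0) x.
Proof.
move=> hA dr; split=> //.
- apply/subspace_continuousP => t; rewrite /= in_itv/= andbT => t0.
  have [|C C0 [lip _ _ _]] := driven_bound dr (T := t + 1); first lra.
  apply: cvg_enorm => e e0; have C1 : 0 < C + 1 by lra.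
  have d0 : 0 < Num.min 1 (e / (C + 1)) by rewrite lt_min ltr01 divr_gt0.
  have := nbhsx_ballx t _ d0; rewrite /within; apply: filterS => s.
  rewrite /ball/= lt_min ltr_pdivlMr// => /andP[ts1 tse]; rewrite in_itv/= andbT => s0.
  have E : `|t - s| * (C + 1) = C * `|t - s| + `|t - s| by ring.
  have [st|ts] := leP s t.
    have [h _] := lip s t s0 st ltac:(lra).
    by move: tse; rewrite E ger0_norm ?subr_ge0// in ts1 *; lra.
  have sT : s <= t + 1 by rewrite ltr0_norm ?subr_lt0// in ts1; lra.
  have [h _] := lip t s t0 (ltW ts) sT.
  by rewrite enormBC; move: tse; rewrite E ltr0_norm ?subr_lt0// in ts1 *; lra.
- move=> K cK K0 e e0.
  have [M [_ HM]] := compact_bounded cK.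
  have KT t : K t -> t <= `|M| + 1.
    move=> Kt; apply: le_trans (ler_norm t) _; apply: HM => //.
    by have := ler_norm M; lra.
  have [|C C0 [lip _ _ _]] := driven_bound dr (T := `|M| + 1); first by rewrite addr_ge0.
  have C1 : 0 < C + 1 by lra.
  exists (e / (C + 1)); first exact: divr_gt0.
  move=> m a b Kab _; rewrite ltr_pdivlMr// => sm.
  have s0 : 0 <= \sum_(i < m) (b i - a i).
    by apply: sumr_ge0 => i _; have [_ _] := Kab i; rewrite subr_ge0.
  apply: (@le_lt_trans _ _ (\sum_(i < m) C * (b i - a i))).
    apply: ler_sum => i _; have [Ka Kb ab] := Kab i.
    have := K0 _ Ka; rewrite /= in_itv/= andbT => a0.
    by have [] := lip (a i) (b i) (ltW a0) ab (KT _ Kb).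
  by rewrite -mulr_sumr; move: sm; rewrite mulrDr mulr1; lra.
pose v t := enorm (velocity (A := A) (x := x) (w := w) t).
have /choice[C CP] (N : nat) : exists C : R, 0 <= C /\ forall s t,
    0 <= s -> s <= t -> t <= N%:R -> [/\ v t - C * t <= v s - C * s
    & enorm (x t - x s) <= (t - s) * (v s + C * (t - s))].
  by have [C] := velocity_almost_decreasing hA dr (ler0n R N); exists C.
pose J (N : nat) : set R := [set t | 0 < t /\ t <= N%:R /\ exists2 e : R, 0 < e &
  forall s, 0 <= s -> s < t -> (v t - C N * t) + e <= v s - C N * s].
have Jc N : countable (J N).
  apply: (@countable_left_jumps (fun t => v t - C N * t)) => s t s0 st tN.
  by have [_ /(_ s t s0 st tN)[]] := CP N.
have cnegl (D : set R) : countable D -> (@lebesgue_measure R).-negligible D.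
  move=> cD; exists D; split=> //; last exact: countable_lebesgue_measure0.
  by apply: countable_measurable => // t; exact: measurable_set1.
have negl : (@lebesgue_measure R).-negligible ([set 0] `|` \bigcup_N J N).
  by apply: negligibleU; [exact/cnegl/countable1|apply: negligible_bigcup => N; exact: cnegl].
apply: negligibleS negl => t /= /not_implyP[t0 nt].
apply: contrapT => nJ; apply: nt.
have tpos : 0 < t.
  rewrite lt_def t0 andbT; apply/eqP => tE; apply: nJ; left.
  by rewrite /= tE.
pose N := (Num.truncn t).+1.
have tN : t <= N%:R by apply: ltW; exact: truncnS_gt.
have [C0 HC] := CP N.
have der : quotient (x := x) t s @[s --> 0^'] --> velocity (A := A) (x := x) (w := w) t.
  apply: (two_sided_velocity hA dr (v := v) (fun _ _ => erefl) tpos tN C0 HC) => e e0.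
  apply: contrapT => ns; apply: nJ; right; exists N => //; split=> //; split=> //.
  exists e => // s s0 st; rewrite leNgt; apply/negP => lt; apply: ns.
  by exists s.
split.
  rewrite /derivable; apply/cvg_ex; exists (velocity (A := A) (x := x) (w := w) t).
  rewrite [X in X @ _](_ : _ = quotient (x := x) t)//.
  by apply/funext => s; rewrite /quotient /= [_%:A]mulr1.
have -> : derive1 x t = velocity (A := A) (x := x) (w := w) t.
  exact: (cvg_lim (@norm_hausdorff _ _) der).
have [Ap _] := proj_ptP (w t) (@maximal_closed_value _ _ A (x t) hA) (driven_dom hA dr t0).
by exists (w t); [exact: (driven_mem dr)|exists (proj_pt (A (x t)) (w t))].
Qed.

(** The right derivative at 0, sampled along the times [1 / (k + 1)]. *)
Lemma driven_bouligand A F S (x w : R -> V) : maximal_monotone A ->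
  driven_trajectory A F x w -> (forall t, 0 <= t -> S (x t)) ->
  bouligand_cone S (x 0) (w 0 - proj_pt (A (x 0)) (w 0)).
Proof.
move=> hA dr Sx; exists (fun k => x k.+1%:R^-1), (fun k => k.+1%:R^-1); split.
- by move=> k; apply: Sx; rewrite invr_ge0.
- by move=> k; rewrite invr_gt0.
- exact: cvg_harmonic.
have h0 : (fun k => k.+1%:R^-1 : R) @ \oo --> 0^'+.
  move=> B nB; have H : \forall k \near \oo, 0 < (k.+1%:R^-1 : R) -> B k.+1%:R^-1.
    exact: (@cvg_harmonic R _ nB).
  by apply: filterS H => k; apply; rewrite invr_gt0.
rewrite [X in X @ _](_ : _ = quotient (x := x) 0 \o (fun k => k.+1%:R^-1)).
  exact: (@cvg_comp _ _ _ _ _ _ _ _ h0 (right_velocity hA dr (lexx 0))).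
by apply/funext => k; rewrite /quotient /= addr0.
Qed.

End Solution.

(** * A Dini inequality for absolutely continuous functions *)

Section AbsolutelyContinuous.
Context {R : realType}.

Definition intervals_in (U : set R) (a t : R) m (u v : 'I_m -> R) : Prop :=
  (forall i, [/\ a <= u i, u i <= v i, v i <= t & `]u i, v i[%classic `<=` U]) /\
  trivIset [set: 'I_m] (fun i => `]u i, v i[%classic).

Lemma intervals_length (U : set R) (a t d : R) m (u v : 'I_m -> R) : open U ->
  (lebesgue_measure U < d%:E)%E -> intervals_in U a t u v ->
  \sum_i (v i - u i) < d.
Proof.
move=> oU Ud [uv tr]; rewrite -lte_fin; apply: le_lt_trans Ud.
have mI i : measurable (`]u i, v i[%classic : set R) by exact: measurable_itv.
have -> : (\sum_i (v i - u i))%:E =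
    lebesgue_measure (\big[setU/set0]_(i < m) `]u i, v i[%classic).
  rewrite measure_bigsetU_ord// -sumEFin; apply: eq_bigr => i _.
  rewrite /= lebesgue_measure_itv/= lte_fin -EFinB; have [_ uvi _ _] := uv i.
  by case: ltgtP uvi => // -> _; rewrite subrr.
apply: le_measure; rewrite ?inE//; first exact: bigsetU_measurable.
  exact: measurable_realfun.open_measurable.
apply: (big_ind (fun X : set R => X `<=` U)); first exact: sub0set.
  by move=> X Y XU YU z [/XU|/YU].
by move=> i _; have [] := uv i.
Qed.

(** A Dini form of the fundamental inequality for absolutely continuous
    functions. Over an open set [U] of small measure around the exceptional
    points the growth is charged to the variation [w] of [g] over [U], which is
    at most [e]; elsewhere it is charged to the slope. The furthest point that
    can be reached this way is the right end of the interval. *)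
Lemma ac_dini_le (g : R -> R) (a b c : R) (N : set R) : a <= b -> 0 <= c ->
  (forall e : R, 0 < e -> exists2 d : R, 0 < d &
    forall m (u v : 'I_m -> R), (forall i, [/\ a <= u i, u i <= v i & v i <= b]) ->
      trivIset [set: 'I_m] (fun i => `]u i, v i[%classic) ->
      \sum_i (v i - u i) < d -> \sum_i `|g (v i) - g (u i)| < e) ->
  (@lebesgue_measure R).-negligible N ->
  (forall t, ~ N t -> a <= t -> t < b -> forall e : R, 0 < e ->
     \forall h \near 0^'+, g (t + h) - g t <= (c + e) * h) ->
  g b - g a <= c * (b - a).
Proof.
move=> ab c0 acg [D [mD mD0 ND]] dini.
have D0 : lebesgue_measure D = 0%E by exact: mD0.
suff main e : 0 < e -> g b - g a <= (c + e) * (b - a) + e.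
  rewrite -subr_le0; apply: (@le0_of_le_small _ _ ((b - a) + 1)) => e e0 _.
  by have := main _ e0; lra.
move=> e0; have [d d0 Hd] := acg _ e0.
have [U [oU DU Ud]] : exists U : set R, [/\ open U, D `<=` U & (lebesgue_measure U < d%:E)%E].
  have [|//|U [oU DU Ud]] := @lebesgue_regularity_outer _ D d mD.
    by rewrite [X in (X < _)%E](_ : _ = 0%E).
  exists U; split=> //; apply: le_lt_trans Ud.
  rewrite -[in leLHS](setDUK DU) (le_trans (measureU2 _ _ _))//; last first.
    by rewrite [X in (X + _)%E](_ : _ = 0%E)// add0e.
  by apply: measurableD => //; exact: measurable_realfun.open_measurable.
pose W t := [set r : R | exists m (u v : 'I_m -> R),
  intervals_in U a t u v /\ r = \sum_i `|g (v i) - g (u i)|].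
have W_lt t r : t <= b -> W t r -> r < e.
  move=> tb [m [u [v [uv ->]]]]; apply: Hd.
  - by move=> i; have [/(_ i)[? ? vt _] _] := uv; split=> //; exact: le_trans vt tb.
  - by case: uv.
  - exact: (intervals_length oU Ud uv).
have W_0 t : W t 0.
  exists 0%N, (fun=> 0), (fun=> 0); split; last by rewrite big_ord0.
  by split; [case|move=> []].
have WS s t r : s <= t -> W s r -> W t r.
  move=> st [m [u [v [[uv tr] ->]]]]; exists m, u, v; split=> //; split=> // i.
  by have [? ? vs ?] := uv i; split=> //; exact: le_trans vs st.
have WD s t r : a <= s -> s <= t -> `]s, t[%classic `<=` U -> W s r ->
    W t (r + `|g t - g s|).
  move=> as_ st stU [m [u [v [[uv tr] ->]]]].
  exists m.+1, (fun i => oapp u s (unlift ord_max i)), (fun i => oapp v t (unlift ord_max i)).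
  split; last first.
    rewrite big_ord_recr /= unlift_none /=; congr (_ + _).
    apply: eq_bigr => i _; rewrite (_ : widen_ord _ i = lift ord_max i) ?liftK//.
    by apply/val_inj; rewrite /= /bump leqNgt ltn_ord.
  split=> [i|].
    case: unliftP => [j _|_] /=; last by [].
    by have [? ? vs ?] := uv j; split=> //; exact: le_trans vs st.
  apply/trivIsetP => i j _ _.
  case: unliftP => [i' ->|->]; case: unliftP => [j' ->|->] /=.
  - by rewrite (inj_eq lift_inj) => ij; move/trivIsetP : tr; apply.
  - move=> _; apply/seteqP; split=> // z [] /=; rewrite !in_itv/= => /andP[_ zv] /andP[sz _].
    by have [_ _ vs _] := uv i'; have := lt_trans (lt_le_trans zv vs) sz; rewrite ltxx.
  - move=> _; apply/seteqP; split=> // z [] /=; rewrite !in_itv/= => /andP[sz _] /andP[_ zv].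
    by have [_ _ vs _] := uv j'; have := lt_trans (lt_le_trans zv vs) sz; rewrite ltxx.
  - by rewrite eqxx.
pose w t := sup (W t).
have hW t : t <= b -> has_sup (W t).
  by move=> tb; split; [exists 0|exists e => r /(W_lt _ _ tb)/ltW].
have w_ub t r : t <= b -> W t r -> r <= w t.
  by move=> tb Wr; apply: ub_le_sup => //; have [] := hW t tb.
have w_e : w b <= e.
  by apply: ge_sup; [exists 0|move=> r /(W_lt _ _ (lexx b))/ltW].
have w_mono s t : s <= t -> t <= b -> w s <= w t.
  by move=> st tb; apply: ge_sup; [exists 0|move=> r /(WS _ _ _ st); exact: w_ub].
have w_add s t : a <= s -> s <= t -> t <= b -> `]s, t[%classic `<=` U ->
    w s + `|g t - g s| <= w t.
  move=> as_ st tb stU; rewrite -lerBrDr; apply: ge_sup; first by exists 0.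
  by move=> r Wr; rewrite lerBrDr; apply: w_ub => //; exact: WD.
(* the set of times up to which the inequality, with the variation over [U]
   added, has been established *)
pose E := [set t | [/\ a <= t, t <= b & g t - g a <= (c + e) * (t - a) + w t]].
have Ea : E a.
  by split=> //; rewrite !subrr mulr0 add0r; apply: w_ub => //; exact: W_0.
have hE : has_sup E by split; [exists a|exists b => t []].
pose T := sup E.
have aT : a <= T by apply: ub_le_sup => //; exact: (proj2 hE).
have Tb : T <= b by apply: ge_sup; [exists a|move=> t []].
have ET : E T.
  split=> //; rewrite -subr_le0.
  apply: (@le0_of_le_small _ _ (1 + (c + e))) => h h0 _.
  have [d' d'0 Hd'] := acg _ h0.
  have [|t Et tT] := @sup_adherent _ E (Num.min d' h) _ hE; first by rewrite lt_min d'0.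
  have tleT : t <= T by apply: ub_le_sup => //; exact: (proj2 hE).
  have [at_ tb Egt] := Et.
  have : \sum_(i < 1) `|g T - g t| < h.
    apply: (Hd' 1%N (fun=> t) (fun=> T)) => [i|i j _ _ _|].
    - by split.
    - by rewrite !ord1.
    - rewrite big_ord_recl big_ord0 addr0; move: tT; rewrite -/T ltrBlDr -ltrBlDl.
      by rewrite lt_min => /andP[].
  rewrite big_ord_recl big_ord0 addr0 => gT.
  have Th : T - t < h.
    by move: tT; rewrite -/T ltrBlDr -ltrBlDl lt_min => /andP[].
  have := ler_norm (g T - g t); have := w_mono _ _ tleT Tb.
  have : (c + e) * (t - a) <= (c + e) * (T - a) by rewrite ler_pM2l; lra.
  have : 0 <= (c + e) * h by rewrite mulr_ge0; lra.
  lra.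
have {}Tb : T = b.
  apply/eqP; rewrite eq_le Tb/= leNgt; apply/negP => Tltb.
  have [_ _ EgT] := ET.
  suff [h [h0 Thb Eh]] : exists h, [/\ 0 < h, T + h <= b & E (T + h)].
    have : T + h <= T by apply: ub_le_sup => //; exact: (proj2 hE).
    by lra.
  have bT0 : 0 < b - T by rewrite subr_gt0.
  have [DT|nDT] := pselect (D T).
    have [r /= r0 rU] : nbhs_ball T U by apply/nbhs_ballP/open_nbhs_nbhs; split=> //; exact: DU.
    exists (Num.min (r / 2) (b - T)).
    set h := Num.min _ _.
    have h0 : 0 < h by rewrite lt_min bT0 andbT; lra.
    have hr : h <= r / 2 by rewrite ge_min lexx.
    have hb : h <= b - T by rewrite ge_min lexx orbT.
    have Thb : T + h <= b by lra.
    split=> //; split=> //; first lra.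
    have ThU : `]T, (T + h)[%classic `<=` U.
      move=> z /=; rewrite in_itv/= => /andP[Tz zT]; apply: rU.
      by rewrite /ball/= distrC gtr0_norm ?subr_gt0//; lra.
    have := w_add T (T + h) aT ltac:(lra) Thb ThU; have := ler_norm (g (T + h) - g T).
    have : 0 <= (c + e) * h by rewrite mulr_ge0; lra.
    lra.
  have near_h := dini T (fun NT => nDT (ND _ NT)) aT Tltb e e0.
  have [h [h0 hb hg]] : exists h, [/\ 0 < h, h <= b - T & g (T + h) - g T <= (c + e) * h].
    near (0 : R)^'+ => h; exists h; split.
    - by near: h; exact: nbhs_right_gt.
    - by near: h; exact: nbhs_right_le.
    - by near: h; exact: near_h.
  exists h; split=> //; first lra.
  split; [lra|lra|].
  have := w_mono T (T + h) ltac:(lra) ltac:(lra); lra.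
have [_ _] := ET; rewrite Tb; lra.
Unshelve. all: by end_near. Qed.

End AbsolutelyContinuous.

(** * Invariance from the normal condition *)

Section Invariance.
Context {R : realType} {n : nat}.
Local Notation V := 'rV[R]_n.
Implicit Types (x y z v a b : V) (A F : V -> set V) (S : set V).

Lemma dist_to_lipschitz S z z' : S !=set0 -> `|dist_to S z - dist_to S z'| <= enorm (z - z').
Proof.
move=> S0.
have le u u' : dist_to S u <= dist_to S u' + enorm (u - u').
  rewrite -lerBlDr; apply: dist_to_glb => // s Ss; rewrite lerBlDr.
  by by apply: le_trans (dist_to_le u Ss) _; rewrite [leRHS]addrC; exact: enorm_dist.
by rewrite ler_norml lerBlDl le lerNl opprB lerBlDl enormBC le.
Qed.

Lemma dist_to_continuous S : S !=set0 -> continuous (dist_to S).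
Proof.
move=> S0 z; apply/(@cvgrPdist_le _ _ _ (nbhs z)) => e e0.
apply: (@filterS _ (nbhs z) _ _ _ _ (near_enorm_lt z e0)) => z' lt.
by apply: le_trans (dist_to_lipschitz _ _ S0) _; rewrite enormBC ltW.
Qed.

Lemma dist_to0 S z : closed S -> S !=set0 -> dist_to S z = 0 -> S z.
Proof.
move=> clS S0 d0; have [s [Ss]] := closed_proj_set z clS S0.
by rewrite d0 => /enorm_eq0/eqP; rewrite subr_eq0 => /eqP ->.
Qed.

(** The pointwise dissipation estimate: with [s] nearest to [z] in [S], the
    vector [z - s] is a proximal normal at [s]; the normal condition there is
    transported to [z] by the Lipschitz property of [F] and the monotonicity of
    [A]. *)
Lemma normal_condition_dissipation A F (L : R) S z s w a :
  maximal_monotone A -> lipschitz_cusco L F -> proj_set S z s ->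
  (forall v, F s v -> forall e : R, 0 < e ->
     exists2 b, A s b & edot (z - s) (v - b) < e) ->
  F z w -> A z a ->
  edot (z - s) (w - a) <= `|L| * dist_to S z ^+ 2.
Proof.
move=> hA hF [Ss ds] cond Fw Aa; rewrite -ds.
have [v Fv vw] := lipschitz_cusco_near s hF Fw.
rewrite -subr_le0; apply: (@le0_of_le_small _ _ 1) => e e0 _; rewrite mulr1.
have [b Ab be] := cond v Fv e e0.
have [mA _] := hA; have mon := mA _ _ _ _ Aa Ab.
have cs := cauchy_schwarz (z - s) (w - v).
have : enorm (z - s) * enorm (w - v) <= enorm (z - s) * (`|L| * enorm (s - z)).
  by rewrite ler_wpM2l ?enorm_ge0// enormBC.
rewrite (enormBC s z) expr2; move: (enorm (z - s)) cs => q cs.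
have E : edot (z - s) (w - a) = edot (z - s) (w - v) + edot (z - s) (v - b) - edot (a - b) (z - s).
  by rewrite (edotC (a - b)); rewrite -edotDr -edotNr -edotDr; congr edot;
    apply/rowP => i; rewrite !mxE; ring.
rewrite E; lra.
Qed.

(** The distance to the fixed point [s] dominates the distance to [S], with equality
    at time [t]. *)
Lemma upper_dini_sqr_dist S (x : R -> V) t s (k : R) :
  proj_set S (x t) s -> derivable x t 1 ->
  edot (x t - s) (derive1 x t) <= k ->
  forall e : R, 0 < e -> \forall h \near 0^'+,
    dist_to S (x (t + h)) ^+ 2 - dist_to S (x t) ^+ 2 <= (2 * k + e) * h.
Proof.
move=> [Ss ds] dx le e e0.
have cq : quotient (x := x) t h @[h --> 0^'+] --> derive1 x t.
  have cq0 : quotient (x := x) t h @[h --> 0^'] --> derive1 x t.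
    move: dx; rewrite /derivable [X in X @ _](_ : _ = quotient (x := x) t)//.
    by apply/funext => h; rewrite /quotient /= [_%:A]mulr1.
  exact: cvg_dnbhs_at_right.
have cl : 2 * edot (x t - s) (quotient (x := x) t h) +
    h * enorm (quotient (x := x) t h) ^+ 2 @[h --> 0^'+] -->
    2 * edot (x t - s) (derive1 x t) + 0 * enorm (derive1 x t) ^+ 2.
  apply: cvgD.
    by apply: cvgM; [exact: cvg_cst|apply: edot_cvg => //; exact: cvg_cst].
  apply: cvgM; last by rewrite expr2; under eq_fun do rewrite expr2; apply: cvgM; exact: enorm_cvg.
  by apply: cvg_at_right_filter; exact: cvg_id.
have lt : 2 * edot (x t - s) (derive1 x t) + 0 * enorm (derive1 x t) ^+ 2 < 2 * k + e.
  by rewrite mul0r addr0; lra.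
near=> h.
have h0 : 0 < h by near: h; exact: nbhs_right_gt.
have H : 2 * edot (x t - s) (quotient (x := x) t h) +
    h * enorm (quotient (x := x) t h) ^+ 2 <= 2 * k + e.
  by near: h; apply: cvgr_le cl _ lt.
rewrite -ds; have := dist_to_le (x (t + h)) Ss.
rewrite -(ler_pXn2r (n := 2))// ?nnegrE ?enorm_ge0 ?dist_to_ge0// => d2.
apply: le_trans (lerB d2 (lexx _)) _.
have -> : x (t + h) - s = (x t - s) + h *: quotient (x := x) t h.
  rewrite /quotient scalerA divff ?gt_eqF// scale1r (addrC h).
  by apply/rowP => i; rewrite !mxE; ring.
move: H; rewrite !enorm_sqr; move: (x t - s) (quotient _ _) => u q H.
have : (2 * edot u q + h * edot q q) * h <= (2 * k + e) * h by rewrite ler_pM2r.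
rewrite !edotE (edotC q u); lra.
Unshelve. all: by end_near. Qed.

(** Gronwall's argument in steps of length [tau]: on such a step the squared
    distance to [S] has slope at most [2 * k] times its maximum, so the maximum is
    at most half of itself. *)
Lemma invariance_of_normal_condition A F (L : R) S :
  maximal_monotone A -> lipschitz_cusco L F -> closed S ->
  (forall x, op_dom A x -> proj_set S x `<=` S `&` op_dom A) ->
  (forall z s, op_dom A z -> proj_set S z s -> forall v, F s v -> forall e : R, 0 < e ->
     exists2 b, A s b & edot (z - s) (v - b) < e) ->
  strong_invariant F A S.
Proof.
move=> hA hF clS projS cond x0 [Sx0 _] x [cx acx x00 aex].
have S0 : S !=set0 by exists x0.
pose d t := dist_to S (x t).
have d_ge0 t : 0 <= d t by exact: dist_to_ge0.
have d0 : d 0 = 0.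
  apply/eqP; rewrite eq_le d_ge0 andbT /d x00.
  by have := dist_to_le x0 Sx0; rewrite subrr enorm0.
have cd : {within `[0, +oo[, continuous d}.
  apply/subspace_continuousP => t t0.
  have cxt : x @ within `[0, +oo[ (nbhs t) --> x t.
    by move/subspace_continuousP : cx; exact.
  have cdt : dist_to S @ x t --> dist_to S (x t) by exact: dist_to_continuous.
  exact: (@cvg_comp _ _ _ x (dist_to S) _ _ _ cxt cdt).
pose k := `|L|; have k0 : 0 <= k := normr_ge0 L.
pose tau := (4 * k + 4)^-1; have tau0 : 0 < tau by rewrite invr_gt0; lra.
have ktau : 4 * (k * tau) <= 1.
  by rewrite mulrA /tau ler_pdivrMr; lra.
have step t1 : 0 <= t1 -> d t1 = 0 -> forall t, t1 <= t -> t <= t1 + tau -> d t = 0.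
  move=> t10 dt1.
  have sub : `[t1, t1 + tau]%classic `<=` (`[0, +oo[%classic : set R).
    by move=> t /=; rewrite !in_itv/= andbT => /andP[t1t _]; exact: le_trans t1t.
  have [|ts /set_mem tsI tsmax] := compact_EVT_max _ (@segment_compact _ t1 (t1 + tau))
      (continuous_subspaceW sub cd).
    by exists t1; rewrite /= in_itv/= lexx lerDl ltW.
  move: tsI; rewrite /= in_itv/= => /andP[t1s stau].
  have dmax t : t1 <= t -> t <= t1 + tau -> d t <= d ts.
    by move=> t1t tt; apply: tsmax; apply/mem_set; rewrite /= in_itv/= t1t.
  suff ds0 : d ts = 0.
    by move=> t t1t tt; apply/eqP; rewrite eq_le d_ge0 andbT -ds0 dmax.
  have [t1E|t1lt] := eqVneq t1 ts; first by rewrite -t1E.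
  have {}t1lt : t1 < ts by rewrite lt_def eq_sym t1lt.
  pose M := d ts.
  have M0 : 0 <= M by exact: d_ge0.
  have incr u : t1 < u -> u <= ts -> M ^+ 2 - d u ^+ 2 <= 2 * (k * M ^+ 2) * (ts - u).
    move=> t1u uts; have u0 : 0 < u by exact: le_lt_trans t10 t1u.
    apply: (@ac_dini_le _ (fun t => d t ^+ 2) u ts (2 * (k * M ^+ 2))
      (~` [set t : R | 0 <= t -> derivable x t 1 /\
        [set v - a | v in F (x t) & a in A (x t)] (derive1 x t)])) => //.
    - by rewrite !mulr_ge0 ?exprn_ge0.
    - move=> e e0; have M1 : 0 < 2 * M + 1 by lra.
      have pos : `[u, ts]%classic `<=` (`]0, +oo[%classic : set R).
        by move=> t /=; rewrite !in_itv/= andbT => /andP[ut _]; exact: lt_le_trans ut.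
      have [dl dl0 Hdl] := acx _ (@segment_compact _ u ts) pos _ (divr_gt0 e0 M1).
      exists dl => // m a b ab tr sm.
      have := Hdl m a b _ tr sm; rewrite ltr_pdivlMr// => H.
      apply: le_lt_trans (H _); last first.
        move=> i; have [ua abi bt] := ab i.
        by split=> //=; rewrite in_itv/=; [rewrite ua (le_trans abi bt)|rewrite bt (le_trans ua abi)].
      rewrite mulr_suml; apply: ler_sum => i _; have [ua abi bt] := ab i.
      rewrite subr_sqr normrM.
      have l1 := dist_to_lipschitz (x (b i)) (x (a i)) S0.
      have l2 : `|d (b i) + d (a i)| <= 2 * M + 1.
        rewrite ger0_norm ?addr_ge0//.
        have := dmax (a i) (le_trans (ltW t1u) ua) (le_trans (le_trans abi bt) stau).
        have := dmax (b i) (le_trans (ltW t1u) (le_trans ua abi)) (le_trans bt stau).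
        by rewrite -/M; lra.
      by apply: ler_pM.
    - move=> t /= /notP good ut tts e e0.
      have t0 : 0 <= t by exact: le_trans (ltW u0) ut.
      have [dx [w Fw [a Aa E]]] := good t0.
      have domt : op_dom A (x t) by exists a.
      have [s ps] := closed_proj_set (x t) clS S0.
      have diss := normal_condition_dissipation hA hF ps (cond _ _ domt ps) Fw Aa.
      rewrite E in diss.
      apply: upper_dini_sqr_dist ps dx _ e e0.
      apply: le_trans diss _; rewrite ler_wpM2l// ler_pXn2r ?nnegrE ?dist_to_ge0//.
      by apply: dmax; [exact: le_trans (ltW t1u) ut|exact: le_trans (ltW tts) stau].
  have half : M ^+ 2 <= M ^+ 2 / 2.
    rewrite -subr_le0; apply: (@le0_of_le_small _ _ 1) => e e0 _; rewrite mulr1.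
    have c0 : d u @[u --> within `[0, +oo[ (nbhs t1)] --> d t1.
      by move/subspace_continuousP : cd; apply; rewrite /= in_itv/= andbT.
    rewrite dt1 in c0.
    have small : \forall u \near t1, 0 <= u -> d u < Num.min e 1.
      have m0 : 0 < Num.min e 1 by rewrite lt_min e0 ltr01.
      have H : \forall u \near t1, `[0, +oo[%classic u -> d u < Num.min e 1.
        exact: (cvgr_lt _ c0 _ m0).
      by apply: filterS H => r Hr r0; apply: Hr; rewrite /= in_itv/= andbT.
    have small' : \forall u \near t1, t1 < u -> 0 <= u -> d u < Num.min e 1.
      by apply: filterS small => r Hr _.
    (* start slightly after [t1]: at [t1 = 0] absolute continuity is not available *)
    near t1^'+ => r.
    have t1u : t1 < r by near: r; exact: nbhs_right_gt.
    have uts : r <= ts by near: r; exact: nbhs_right_le.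
    have du : d r < Num.min e 1.
      have := le_trans t10 (ltW t1u); near: r; exact: small'.
    move: du; rewrite lt_min => /andP[due du1].
    have due2 : d r ^+ 2 <= e.
      have := d_ge0 r; move: (d r) due du1 => q qe q1 q0.
      by rewrite expr2; nra.
    have q0 : 0 <= M ^+ 2 by rewrite exprn_ge0.
    have := incr r t1u uts.
    have l1 : k * M ^+ 2 * (ts - r) <= k * M ^+ 2 * tau.
      by rewrite ler_wpM2l ?mulr_ge0//; lra.
    have l2 : 4 * (k * tau) * M ^+ 2 <= 1 * M ^+ 2 by rewrite ler_wpM2r.
    by lra.
  have : M ^+ 2 <= 0 by lra.
  by move=> h; apply/eqP; rewrite -sqrf_eq0 eq_le h exprn_ge0.
have all N t : 0 <= t -> t <= N%:R * tau -> d t = 0.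
  elim: N t => [|N IH] t t0 tN.
    by rewrite (_ : t = 0)//; apply/eqP; rewrite eq_le t0 andbT; rewrite mul0r in tN.
  have [le|lt] := leP t (N%:R * tau); first exact: IH.
  have N0 : 0 <= N%:R * tau by rewrite mulr_ge0// ltW.
  apply: (step (N%:R * tau)) => //; first exact: IH.
    exact: ltW.
  by move: tN; rewrite -natr1 mulrDl mul1r.
move=> t t0; apply: dist_to0 => //; apply: (all (Num.truncn (t / tau)).+1) => //.
by rewrite -ler_pdivrMr// ltW// truncnS_gt.
Unshelve. all: by end_near. Qed.

End Invariance.

(** * The equivalences *)

Theorem theorem4p5 (R : realType) (n : nat)
    (A F : 'rV[R]_n -> set 'rV[R]_n) (L : R) (S : set 'rV[R]_n)
    (NS TS : 'rV[R]_n -> set 'rV[R]_n)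
    (hA : maximal_monotone A) (hF : lipschitz_cusco L F)
    (clS : closed S) (subS : S `<=` closure (op_dom A))
    (projS : forall x, op_dom A x -> proj_set S x `<=` S `&` op_dom A)
    (hN : NS = proximal_normal_cone S \/ NS = frechet_normal_cone S)
    (hT : TS = bouligand_cone S \/
          TS = (fun x => closed_convex_hull (bouligand_cone S x))) :
  [<-> (* (i) *)
       strong_invariant F A S;
       (* (ii) *)
       forall x, (S `&` op_dom A) x -> forall v, F x v ->
         TS x (v - proj_pt (A x) v);
       (* (iii) *)
       forall x, (S `&` op_dom A) x -> forall v, F x v ->
         ([set v - xs | xs in A x] `&` TS x) !=set0;
       (* (iv) *)
       forall x, (S `&` op_dom A) x ->
         (ereal_sup [set ereal_sup [set
            (edot xi (v - proj_pt (A x) v))%:E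
            | v in F x] | xi in NS x] <= 0)%E;
       (* (v) *)
       forall x, (S `&` op_dom A) x ->
         (ereal_sup [set ereal_sup [set ereal_inf [set
            (edot xi (v - xs))%:E
            | xs in A x] | v in F x] | xi in NS x] <= 0)%E;
       (* (vi) *)
       forall x, (S `&` op_dom A) x ->
         (ereal_sup [set ereal_sup [set ereal_inf [set
            (edot xi (v - xs))%:E
            | xs in A x `&` eball (norm_set (F x) + enorm (min_norm_elt A x))]
            | v in F x] | xi in NS x] <= 0)%E].
Proof.
have proxN x : proximal_normal_cone S x `<=` NS x.
  by case: hN => -> // xi; exact: proximal_sub_frechet.
have boulT x : bouligand_cone S x `<=` TS x.
  by case: hT => -> //; exact: sub_smallest.
have polar x xi v : NS x xi -> TS x v -> edot xi v <= 0.
  move=> Nxi Tv; have Fxi : frechet_normal_cone S x xi.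
    by move: Nxi; case: hN => -> // /proximal_sub_frechet.
  move: Tv; case: hT => ->; first exact: frechet_polar_bouligand.
  exact: frechet_polar_hull.
have clA x := @maximal_closed_value _ _ A x hA.
have projA x v : op_dom A x -> A x (proj_pt (A x) v).
  by move=> domx; have [] := proj_ptP v (clA x) domx.
have sup2P x (f : 'rV[R]_n -> 'rV[R]_n -> \bar R) :
    (ereal_sup [set ereal_sup [set f xi v | v in F x] | xi in NS x] <= 0)%E <->
    forall xi v, NS x xi -> F x v -> (f xi v <= 0)%E.
  split=> [h xi v Nxi Fv|h].
    apply: le_trans h; apply: le_trans (ereal_sup_ubound (imageP _ Nxi)).
    by apply: ereal_sup_ubound; exists v.
  by apply: ge_ereal_sup => _ [xi Nxi <-]; apply: ge_ereal_sup => _ [v Fv <-]; exact: h.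
have i_ii : strong_invariant F A S -> forall x, (S `&` op_dom A) x -> forall v, F x v ->
    TS x (v - proj_pt (A x) v).
  move=> inv x0 [Sx0 [a Aa]] v Fv; apply: boulT.
  have [x [w [xx0 wv dr]]] := driven_trajectory_exists hA hF Aa Fv.
  rewrite -xx0 -wv; apply: (driven_bouligand hA dr) => t t0.
  apply: (inv x0 _ x) => //; first by split=> //; apply: subset_closure; exists a.
  by rewrite -xx0; exact: driven_is_solution hA dr.
have ii_iv : (forall x, (S `&` op_dom A) x -> forall v, F x v ->
    TS x (v - proj_pt (A x) v)) -> forall x, (S `&` op_dom A) x ->
    (ereal_sup [set ereal_sup [set (edot xi (v - proj_pt (A x) v))%:E
       | v in F x] | xi in NS x] <= 0)%E.
  move=> ii x Sx; apply/(sup2P x (fun xi v => (edot xi (v - proj_pt (A x) v))%:E)).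
  by move=> xi v Nxi Fv; rewrite lee_fin; apply: polar Nxi _; exact: ii.
have iii_v : (forall x, (S `&` op_dom A) x -> forall v, F x v ->
    ([set v - xs | xs in A x] `&` TS x) !=set0) -> forall x, (S `&` op_dom A) x ->
    (ereal_sup [set ereal_sup [set ereal_inf [set (edot xi (v - xs))%:E
      | xs in A x] | v in F x] | xi in NS x] <= 0)%E.
  move=> iii x Sx; apply/(sup2P x (fun xi v => ereal_inf [set (edot xi (v - xs))%:E | xs in A x])).
  move=> xi v Nxi Fv; have [_ [[xs Axs <-] Txs]] := iii x Sx v Fv.
  apply: ge_ereal_inf; exists (edot xi (v - xs))%:E; first by exists xs.
  by rewrite lee_fin; exact: polar Nxi Txs.
have v_i : (forall x, (S `&` op_dom A) x ->
    (ereal_sup [set ereal_sup [set ereal_inf [set (edot xi (v - xs))%:E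
      | xs in A x] | v in F x] | xi in NS x] <= 0)%E) -> strong_invariant F A S.
  move=> cond; apply: (invariance_of_normal_condition hA hF clS projS) => z s domz ps v Fv e e0.
  have /sup2P/(_ (z - s) v (proxN _ _ (proj_proximal ps)) Fv) := cond s (projS z domz s ps).
  have e0' : (0 < e%:E)%E by rewrite lte_fin.
  by move=> /le_lt_trans/(_ e0')/ereal_inf_lt[_ [b Ab <-]]; rewrite lte_fin; exists b.
have iv_vi : (forall x, (S `&` op_dom A) x ->
    (ereal_sup [set ereal_sup [set (edot xi (v - proj_pt (A x) v))%:E
       | v in F x] | xi in NS x] <= 0)%E) -> forall x, (S `&` op_dom A) x ->
    (ereal_sup [set ereal_sup [set ereal_inf [set (edot xi (v - xs))%:E
      | xs in A x `&` eball (norm_set (F x) + enorm (min_norm_elt A x))]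
      | v in F x] | xi in NS x] <= 0)%E.
  move=> iv x Sx; have [_ domx] := Sx.
  apply/(sup2P x (fun xi v => ereal_inf [set (edot xi (v - xs))%:E
    | xs in A x `&` eball (norm_set (F x) + enorm (min_norm_elt A x))])).
  move=> xi v Nxi Fv; have /sup2P/(_ xi v Nxi Fv) le := iv x Sx.
  apply: ge_ereal_inf; exists (edot xi (v - proj_pt (A x) v))%:E => //.
  exists (proj_pt (A x) v) => //; split; first exact: projA.
  apply: le_trans (proj_pt_norm v (clA x) (maximal_convex_value hA) domx) _.
  rewrite lerD2r; have [/(_ x)[_ _ /compact_ebounded[r Fr]] _] := hF.
  by apply: ub_le_sup; [exists r => _ [u /Fr ? <-]|exists v].
have vi_v : (forall x, (S `&` op_dom A) x ->
    (ereal_sup [set ereal_sup [set ereal_inf [set (edot xi (v - xs))%:E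
      | xs in A x `&` eball (norm_set (F x) + enorm (min_norm_elt A x))]
      | v in F x] | xi in NS x] <= 0)%E) -> forall x, (S `&` op_dom A) x ->
    (ereal_sup [set ereal_sup [set ereal_inf [set (edot xi (v - xs))%:E
      | xs in A x] | v in F x] | xi in NS x] <= 0)%E.
  move=> vi x Sx; apply/(sup2P x (fun xi v => ereal_inf [set (edot xi (v - xs))%:E | xs in A x])).
  move=> xi v Nxi Fv; have /sup2P/(_ xi v Nxi Fv) := vi x Sx; apply: le_trans.
  apply/ereal_infP => _ [xs [Axs _] <-].
  by apply: ereal_inf_lbound; exists xs.
tfae.
- exact: i_ii.
- move=> ii x Sx v Fv; exists (v - proj_pt (A x) v); split; last exact: ii.
  by exists (proj_pt (A x) v) => //; apply: projA; case: Sx.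
- by move=> /iii_v/v_i/i_ii/ii_iv.
- by move=> /iv_vi/vi_v.
- by move=> /v_i/i_ii/ii_iv/iv_vi.
- by move=> /vi_v/v_i.
Qed.
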